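(* For every real $c$ with $-2<c\le 0$, $$\lim_{n\to\infty}\frac1n\log P\big(L_{\max}(n)<(2+c)\sqrt n\big)=-2H_0(c),$$ where $$H_0(c)=-\frac12+\frac{(2+c)^2}{8}+\log\frac{c+2}{2}-\Big(1+\frac{(c+2)^2}{4}\Big)\log\Big(\frac{2(c+2)^2}{4+(c+2)^2}\Big).$$
   Context: $L_{\max}(n)$ denotes the length of the longest increasing subsequence of a uniformly random permutation of $\{1,\dots,n\}$. (Equivalently in law: for $n$ i.i.d. points $(X_i,Y_i)$ uniformly distributed on $[0,1]^2$, it is the maximal $\ell$ for which there are indices $i_1,\dots,i_\ell$, not required to be increasing, with $X_{i_j}<X_{i_{j+1}}$ and $Y_{i_j}<Y_{i_{j+1}}$ for $j=1,\dots,\ell-1$.) *)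

(* Defs.v *)
From mathcomp Require Import all_boot all_order all_fingroup all_algebra.
From mathcomp Require Import all_classical all_reals all_analysis.

Set Implicit Arguments.
Unset Strict Implicit.
Unset Printing Implicit Defensive.

Import Order.TTheory GRing.Theory Num.Theory.
Import numFieldNormedType.Exports.

Local Open Scope ring_scope.

(* A subsequence of s(0), ..., s(n-1) is identified with its set of positions. *)
Definition increasing_on (n : nat) (s : 'S_n) (A : {set 'I_n}) : bool :=
  [forall i in A, forall j in A, (i < j)%N ==> (s i < s j)%N].

Definition Lmax (n : nat) (s : 'S_n) : nat :=
  (\max_(A : {set 'I_n} | increasing_on s A) #|A|)%N.

Definition uniform_prob (R : realType) (T : finType) (A : {set T}) : R :=
  #|A|%:R / #|T|%:R.

Definition prob_Lmax_lt (R : realType) (n : nat) (x : R) : R :=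
  uniform_prob R [set s : 'S_n | (Lmax s)%:R < x].

Definition H0 (R : realType) (c : R) : R :=
  - (1 / 2) + (2 + c) ^+ 2 / 8 + ln ((c + 2) / 2)
  - (1 + (c + 2) ^+ 2 / 4) * ln (2 * (c + 2) ^+ 2 / (4 + (c + 2) ^+ 2)).

(* Main.v *)
Require Import Defs.
From mathcomp Require Import all_boot all_order all_fingroup all_algebra.
From mathcomp Require Import zify ring lra.

(** Write alpha = 2 + c, so that the event is Lmax <= l with l close to
    alpha sqrt n.

    Row insertion turns a permutation with Lmax <= l into a pair of standard
    tableaux of the same shape with at most l columns.  If the columns have
    lengths c_0 >= ... >= c_(l-1) and h_j = c_j + l - 1 - j, then the number of
    tableaux of the shape is n! times the determinant [schur] of the
    1 / (h_j - q)!, which up to sign is the Vandermonde product of the h_j over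
    the product of the h_j!.  There are at most (n + 2) ^ l shapes, which is
    exp (o(n)), so only the largest value of [schur] ^ 2 matters
    ([card_Lmax_upper], [card_Lmax_lower]): a discrete Coulomb gas with l
    particles and weight 1 / h! ^ 2.

    This weight is not a classical one, but 4 ^ h h! ^ 2 lies between (2h)! and
    (2h + 1)!, so at the doubled points 2h or 2h + 1 it is comparable with the
    Poisson weight w(x) = mu ^ x / x!, whose orthogonal polynomials are the
    Charlier polynomials, of norm k! mu ^ k e ^ mu.  Here mu is a free parameter.

    - Upper bound ([schur_upper]): the Vandermonde product at the points 2h_j is
      the determinant of the Charlier polynomials there, and each value of a
      Charlier polynomial is bounded by its norm.
    - Lower bound ([schur_lower]): choose odd points one after the other, each
      one where the monic polynomial vanishing at the previous ones is large
      relative to the weight (Leja points).  This works because a polynomial p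
      of degree less than l keeps a fixed fraction of its Poisson mass on the odd
      integers ([odd_mass]) when l / mu stays below 1: the matrix of (-1) ^ x in
      the Charlier basis is again made of Charlier polynomials, for the
      parameter 4 mu, at arguments where these are exponentially small
      ([charlier_gram_alt_le]).

    Both bounds read (4 / mu ^ 2) ^ m Phi(mu, l) up to exp (o(n)), where m is the
    number of boxes.  The upper bound holds for all mu and m, the lower one for
    an m which the construction does not control.  Comparing the lower bound at
    mu = lam sqrt n with the upper bound at nearby parameters forces m / n to be
    close to alpha lam / 2 - alpha ^ 2 / 4, which is 1 for
    lam = (4 + alpha ^ 2) / (2 alpha).  Since P (Lmax <= l) decreases with the
    size of the permutation, it suffices that m is at least n; taking lam
    slightly larger ensures that ([exponent_lower]).  The upper bound at this lam
    and Stirling's formula then give the matching exponent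
    ([exponent_upper], [rate_value]). *)

Set Implicit Arguments.
Unset Strict Implicit.
Unset Printing Implicit Defensive.

Import Order.TTheory GRing.Theory Num.Theory.

(** * Row insertion on lattice words *)

Definition rowlen (w : seq (option nat)) (k : nat) : nat := count_mem (Some k) w.
Arguments rowlen : simpl never.

(** A row of the growth diagram of a permutation is a chain of partitions, each
    equal to the previous one or larger by one box.  It is stored as the list of
    the rows that receive a box, [None] for no box, with the last step at the
    head, so that the tails of a word are the initial parts of the chain.  The
    condition below says that all members of the chain are partitions. *)
Fixpoint lattice (w : seq (option nat)) : bool :=
  if w is a :: v then
    lattice v && (if a is Some k.+1 then rowlen v k.+1 < rowlen v k else true)
  else true.

(** Positions are numbered from the end of the list, so that they do not change
    when the word is extended at its head. *)
Fixpoint vacant (w : seq (option nat)) (x : nat) : bool :=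
  if w is a :: v then (if x == size v then a == None else vacant v x) else false.

(** Fomin's local rule, applied along a row of the growth diagram: a new point
    at position x adds a box to row 0; from there on, the new box sits in some
    row i of the difference between the new and the old chain, and it moves to
    row i + 1 when the old chain adds a box to row i.  The final i is returned
    with the new word: it is the step of the recording tableau. *)
Fixpoint insert (w : seq (option nat)) (x : nat) : seq (option nat) * nat :=
  if w is a :: v then
    if x == size v then (Some 0 :: v, 0)
    else let: (v', i) := insert v x in
         if a == Some i then (Some i.+1 :: v', i.+1) else (a :: v', i)
  else ([::], 0).

Fixpoint delete (w : seq (option nat)) (i : nat) : seq (option nat) * nat :=
  if w is a :: v then
    if a == Some i then
      if i is j.+1 then let: (v', x) := delete v j in (Some j :: v', x)
      else (None :: v, size v)
    else let: (v', x) := delete v i in (a :: v', x)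
  else ([::], 0).

Lemma eqSome (i k : nat) : (Some i == Some k) = (i == k).
Proof. by []. Qed.

Lemma rowlen_cons a w k : rowlen (a :: w) k = (a == Some k) + rowlen w k.
Proof. by []. Qed.

Lemma lattice_rowlen w k : lattice w -> rowlen w k.+1 <= rowlen w k.
Proof.
elim: w k => //= a w IH k /andP[/IH H Ha].
rewrite !rowlen_cons; have := H k.
case: a Ha => [[|j]|] //=; rewrite ?eqSome; try lia.
by case: (eqVneq j k) => [->|]; lia.
Qed.

Lemma vacant_size w x : vacant w x -> x < size w.
Proof. by elim: w => //= a w IH; case: eqP => [->|_ /IH] //; lia. Qed.

Lemma size_insert w x : size (insert w x).1 = size w.
Proof.
elim: w => //= a w IH; case: eqP => // _.
by case: (insert w x) IH => v i /= IH; case: ifP => _ /=; rewrite IH.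
Qed.

Lemma rowlen_insert w x k : vacant w x ->
  rowlen (insert w x).1 k = rowlen w k + (k == (insert w x).2).
Proof.
elim: w k => //= a w IH k.
case: eqP => [_ /eqP ->|_ /IH H]; first by rewrite !rowlen_cons eqSome /=; lia.
case E: (insert w x) H => [v i] /= H.
by case: ifP => [/eqP ->|Ha]; rewrite !rowlen_cons H ?eqSome /=; [rewrite (eq_sym k i) (eq_sym k); lia | rewrite addnA].
Qed.

Lemma vacant_insert w x y : vacant w x -> vacant (insert w x).1 y = vacant w y && (y != x).
Proof.
elim: w => //= a w IH.
case: (eqVneq x (size w)) => [-> /eqP -> /=|nx fx].
  by case: (eqVneq y (size w)) => //=; rewrite andbT.
have := size_insert w x; have := IH fx.
case E: (insert w x) => [v i] /= IHv sv.
case: (eqVneq a (Some i)) => [->|na] /=; rewrite sv.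
  by case: (eqVneq y (size w)).
case: (eqVneq y (size w)) => // ->; rewrite (eq_sym (size w)) nx andbT //.
Qed.

Lemma insert_lattice w x : vacant w x -> lattice w -> lattice (insert w x).1.
Proof.
elim: w => //= a w IH.
case: eqP => [_ _ /andP[lw _]|_ fx /andP[lw la]]; first by rewrite /= lw.
have := rowlen_insert _ fx; have := IH fx lw.
case E: (insert w x) => [v i] /= lv rv.
case: (eqVneq a (Some i)) => [Ha|na] /=; rewrite lv /=.
  by rewrite !rv; have := lattice_rowlen i lw; lia.
case: a la na => [[|k]|] //; rewrite !rv eqSome; lia.
Qed.

Lemma delete_insert w x : vacant w x ->
  delete (insert w x).1 (insert w x).2 = (w, x).
Proof.
elim: w => //= a w IH.
case: (eqVneq x (size w)) => [-> /eqP -> //|_ /IH].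
case E: (insert w x) => [v i] /= H.
case: (eqVneq a (Some i)) => [->|/negbTE na] /=; first by rewrite eqxx H.
by rewrite na H.
Qed.

(** The local rule can be undone from right to left: the partition minus its
    box in row i stays a partition along the way, and since the empty partition
    has no box to remove, a step that adds a box to row 0 must be met. *)
Lemma insert_delete w i : lattice w -> rowlen w i.+1 < rowlen w i ->
  [/\ vacant (delete w i).1 (delete w i).2, lattice (delete w i).1
    & insert (delete w i).1 (delete w i).2 = (w, i)].
Proof.
elim: w i => //= a w IH i /andP[lw la].
rewrite !rowlen_cons; case: (eqVneq a (Some i)) => [Ea|na] Hi.
  case: i Ea Hi => [|j] Ea Hi; first by rewrite /= !eqxx lw Ea.
  rewrite Ea in la.
  have [] := IH j lw la; case E: (delete w j) => [v x] /= fv lv iv.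
  have := size_insert v x; have := rowlen_insert _ fv; rewrite iv /= => rv sv.
  have sx := vacant_size fv.
  rewrite Ea !eqxx /= ltn_eqF //= lv fv /=; split => //.
  case: j {IH E la Hi iv Ea} rv => // j rv.
  have := lattice_rowlen j lw; rewrite !rv eqxx (ltn_eqF (ltnSn j)); lia.
have Hw : rowlen w i.+1 < rowlen w i by lia.
have [] := IH i lw Hw; case E: (delete w i) => [v x] /= fv lv iv.
have := size_insert v x; have := rowlen_insert _ fv; rewrite iv /= => rv sv.
have sx := vacant_size fv.
rewrite ltn_eqF //= lv fv (negbTE na) /=; split => //.
move: na la Hi; case: a => [[|k]|] //.
by rewrite !rv !eqSome; case: (eqVneq k i) => [->|]; rewrite ?eqxx; lia.
Qed.

(** * Row insertion computes longest increasing subsequences *)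

(** The points of t arrive in the order of the list read from its end. *)
Definition RS (n : nat) (t : seq nat) : seq (option nat) :=
  foldr (fun x w => (insert w x).1) (nseq n None) t.

Lemma size_RS n t : size (RS n t) = n.
Proof. by elim: t => [|x t IH] /=; rewrite ?size_nseq // size_insert. Qed.

Lemma vacant_nseq n x : vacant (nseq n None) x = (x < n).
Proof.
elim: n => //= n ->; rewrite size_nseq.
by rewrite [RHS]ltnS [RHS]leq_eqVlt; case: (eqVneq x n) => /=.
Qed.

Lemma lattice_nseq n : lattice (nseq n None).
Proof. by elim: n => //= n ->. Qed.

Lemma RS_valid n t : uniq t -> all (ltn^~ n) t ->
  lattice (RS n t) /\ forall x, vacant (RS n t) x = (x < n) && (x \notin t).
Proof.
elim: t => [|y t IH] /=.
  by move=> _ _; split=> [|x]; rewrite ?lattice_nseq // vacant_nseq andbT.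
move=> /andP[yt ut] /andP[yn tn]; have [lw fw] := IH ut tn.
have fy : vacant (RS n t) y by rewrite fw yn.
split=> [|x]; first exact: insert_lattice.
by rewrite vacant_insert // fw inE negb_or -andbA [in RHS](andbC (x != y)).
Qed.

Lemma drop_insert w x d : x < size w ->
  drop d (insert w x).1 =
  if x < size w - d then (insert (drop d w) x).1 else drop d w.
Proof.
elim: w d => [|a w IH] [|d] //=; first by rewrite ?subn0 => ->; rewrite ?drop0.
rewrite subSS ltnS; case: (eqVneq x (size w)) => [-> _|nx xs].
  by rewrite ltnNge leq_subr.
have {nx}xs : x < size w by lia.
rewrite -IH //.
by case: (insert w x) => v i; case: ifP.
Qed.

Lemma vacant_drop w x d : vacant w x -> x < size w - d -> vacant (drop d w) x.
Proof.
elim: w d => [|a w IH] [|d] //=.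
by rewrite subSS; case: eqP => [->|_ fx /IH ->] //; rewrite ltnNge leq_subr.
Qed.

Definition zeros (w : seq (option nat)) (j : nat) : nat :=
  rowlen (drop (size w - j) w) 0.

(** Only the first later step that adds a box to row 0 is changed by an
    insertion at x, so the number of such steps either follows its value at x or
    is already larger there.  This is patience sorting. *)
Lemma insert_row0 w x : vacant w x ->
  if (insert w x).2 == 0 then rowlen w 0 = zeros w x else zeros w x < rowlen w 0.
Proof.
elim: w => //= a w IH.
have zE : x <= size w -> zeros (a :: w) x = zeros w x.
  by move=> xs; rewrite /zeros /= subSn.
case: (eqVneq x (size w)) => [Ex /eqP Ea /=|_ fx].
  by rewrite zE ?Ex // /zeros subnn drop0 rowlen_cons Ea.
rewrite zE ?(ltnW (vacant_size fx)) //; have := IH fx.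
case: (insert w x) => v i /=; rewrite rowlen_cons.
case: (eqVneq a (Some i)) => [->|na] /=; rewrite ?eqSome.
  by case: (eqVneq i 0) => /= _; lia.
case: (eqVneq i 0) na => /= [->|_] na; first by rewrite (negbTE na).
by move=> h; apply: leq_trans h (leq_addl _ _).
Qed.

Lemma zeros_insert w x j : vacant w x -> j <= size w ->
  zeros (insert w x).1 j =
  if j <= x then zeros w j else maxn (zeros w j) (zeros w x).+1.
Proof.
move=> fx js; have xs := vacant_size fx.
rewrite /zeros size_insert drop_insert // subKn // ltnNge.
case: leqP => //= xj.
set d := size w - j; set u := drop d w.
have su : size u = j by rewrite /u size_drop /d; lia.
have fu : vacant u x.
  by apply: vacant_drop => //; rewrite /d subKn.
rewrite rowlen_insert //.
have := insert_row0 fu.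
have -> : zeros u x = zeros w x.
  by rewrite /zeros /u size_drop drop_drop /d; congr (rowlen (drop _ _) _); lia.
rewrite -/(zeros w x); case: (insert u x).2 => [|i] /=; rewrite -/u; lia.
Qed.

(** The recursion of last passage percolation: the longest increasing
    subsequence among the values below j ends below x, or passes through the
    last point x. *)
Fixpoint lis (t : seq nat) (j : nat) : nat :=
  if t is x :: u then
    if j <= x then lis u j else maxn (lis u j) (lis u x).+1
  else 0.

Lemma zeros_RS n t j : uniq t -> all (ltn^~ n) t -> j <= n ->
  zeros (RS n t) j = lis t j.
Proof.
elim: t j => [|x t IH] j /=.
  move=> _ _ jn; rewrite /zeros drop_nseq /rowlen.
  by elim: (n - _).
move=> /andP[xt ut] /andP[xn tn] jn.
have [lw fw] := RS_valid ut tn.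
rewrite zeros_insert ?size_RS ?fw ?xn //= !IH //.
exact: ltnW.
Qed.

Lemma rowlen0_RS n t : uniq t -> all (ltn^~ n) t -> rowlen (RS n t) 0 = lis t n.
Proof.
by move=> ut tn; rewrite -(zeros_RS ut tn) // /zeros size_RS subnn drop0.
Qed.

Definition revseq (f : nat -> nat) (m : nat) : seq nat := rev (mkseq f m).

Lemma revseqS f m : revseq f m.+1 = f m :: revseq f m.
Proof. by rewrite /revseq mkseqS rev_rcons. Qed.

Lemma increasing_sub n (s : 'S_n) (A B : {set 'I_n}) :
  B \subset A -> increasing_on s A -> increasing_on s B.
Proof.
move=> /subsetP BA /forall_inP iA; apply/forall_inP => i /BA Ai.
by apply/forall_inP => j /BA Aj; move/forall_inP: (iA i Ai); apply.
Qed.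

Lemma lis_ge n (s : 'S_n) (f : nat -> nat) m j (A : {set 'I_n}) :
  (forall i : 'I_n, f i = s i :> nat) -> m <= n -> increasing_on s A ->
  (forall i, i \in A -> (i < m) && (s i < j)) -> #|A| <= lis (revseq f m) j.
Proof.
move=> fE; elim: m j A => [|m IH] j A mn iA hA.
  suff -> : A = set0 by rewrite cards0.
  by apply/setP => i; rewrite inE; apply/negP => /hA.
rewrite revseqS /=; pose o := Ordinal mn.
have -> : f m = s o by rewrite -fE.
case: (boolP (o \in A)) => oA; last first.
  have := IH j A (ltnW mn) iA => /(_ _) H.
  have {}H : #|A| <= lis (revseq f m) j.
    apply: H => i Ai; have /andP[im ->] := hA i Ai; rewrite andbT.
    rewrite ltn_neqAle -ltnS im andbT; apply: contraNneq oA => E.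
    by rewrite (_ : o = i) //; apply: val_inj.
  by case: ifP => // _; rewrite leq_max H.
have /andP[_ soj] := hA o oA; rewrite [j <= _]leqNgt soj /= leq_max; apply/orP; right.
rewrite (cardsD1 o) oA add1n ltnS; apply: IH; first exact: ltnW.
  by apply: increasing_sub iA; apply: subD1set.
move=> i; rewrite !inE => /andP[io Ai]; have /andP[im _] := hA i Ai.
have {}im : i < m.
  rewrite ltn_neqAle -ltnS im andbT; apply: contraNneq io => E.
  by apply/eqP/val_inj.
by rewrite im; move/forall_inP: iA => /(_ i Ai)/forall_inP/(_ o oA)/implyP; apply.
Qed.

Lemma lis_le n (s : 'S_n) (f : nat -> nat) m j :
  (forall i : 'I_n, f i = s i :> nat) -> m <= n ->
  exists A : {set 'I_n}, [/\ increasing_on s A,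
    forall i, i \in A -> (i < m) && (s i < j) & #|A| = lis (revseq f m) j].
Proof.
move=> fE; elim: m j => [|m IH] j mn.
  exists set0; rewrite cards0; split => // [|i]; last by rewrite inE.
  by apply/forall_inP => i; rewrite inE.
rewrite revseqS /=; pose o := Ordinal mn.
have -> : f m = s o by rewrite -fE.
have [A [iA hA cA]] := IH j (ltnW mn).
have old : exists A : {set 'I_n}, [/\ increasing_on s A,
    forall i, i \in A -> (i < m.+1) && (s i < j) & #|A| = lis (revseq f m) j].
  exists A; split => // i /hA/andP[im ->]; rewrite andbT; exact: ltnW.
case: (leqP j (s o)) => soj; first exact: old.
case: (leqP (lis (revseq f m) (s o)).+1 (lis (revseq f m) j)) => _.
  exact: old.
have [B [iB hB cB]] := IH (s o) (ltnW mn).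
have oB : o \notin B by apply/negP => /hB; rewrite /= ltnn.
exists (o |: B); split.
- apply/forall_inP => i; rewrite !inE => Hi; apply/forall_inP => k.
  rewrite !inE => Hk; apply/implyP.
  case/predU1P: Hi => [->|Bi]; case/predU1P: Hk => [->|Bk].
  + by rewrite ltnn.
  + by have /andP[km _] := hB k Bk; rewrite [o < k]ltnNge (ltnW km).
  + by have /andP[] := hB i Bi.
  + by move/forall_inP: iB => /(_ i Bi)/forall_inP/(_ k Bk)/implyP.
- move=> i; rewrite !inE => /predU1P[->|/hB/andP[im si]].
    by rewrite ltnSn.
  by rewrite (leqW im) (ltn_trans si).
- by rewrite cardsU1 oB cB add1n.
Qed.

Lemma Lmax_lis n (s : 'S_n) (f : nat -> nat) :
  (forall i : 'I_n, f i = s i :> nat) -> Lmax s = lis (revseq f n) n.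
Proof.
move=> fE; apply/eqP; rewrite eqn_leq; apply/andP; split.
  apply/bigmax_leqP => A iA; apply: (lis_ge fE) => // i _.
  by rewrite !ltn_ord.
have [A [iA hA <-]] := lis_le n fE (leqnn n).
exact: (@leq_bigmax_cond _ (increasing_on s) (fun A => #|A|)).
Qed.

Lemma ltn_lift n (k : 'I_n.+1) (i j : 'I_n) : (lift k i < lift k j) = (i < j).
Proof. by rewrite !ltnNge /= leq_bump2. Qed.

Lemma perm_lift n (s : 'S_n.+1) : {s' : 'S_n |
  forall i, s (lift ord0 i) = lift (s ord0) (s' i)}.
Proof.
have ne i : s (lift ord0 i) != s ord0 by rewrite (inj_eq perm_inj) eq_sym neq_lift.
pose f i := if unlift (s ord0) (s (lift ord0 i)) is Some j then j else i.
have fE i : s (lift ord0 i) = lift (s ord0) (f i).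
  by rewrite /f; case: unliftP (ne i) => [j -> //|->]; rewrite eqxx.
have fi : injective f.
  by move=> i j E; apply: (@lift_inj _ ord0); apply: (@perm_inj _ s); rewrite !fE E.
by exists (perm fi) => i; rewrite permE.
Qed.

(** Deleting the first point of a permutation of n + 1 letters gives a
    permutation of n letters with no longer increasing subsequence, and the
    value of the deleted point recovers the permutation.  Hence P (Lmax <= l) is
    a decreasing function of the size. *)
Lemma card_Lmax_succ n l :
  #|[set s : 'S_n.+1 | Lmax s <= l]| <= n.+1 * #|[set s : 'S_n | Lmax s <= l]|.
Proof.
pose f (s : 'S_n.+1) := (s ord0, sval (perm_lift s)).
have finj : injective f.
  move=> s s' [E0 E1]; apply/permP => i.
  case: (unliftP ord0 i) => [j ->|-> //].
  by rewrite (svalP (perm_lift s)) (svalP (perm_lift s')) E1 E0.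
rewrite -(card_imset _ finj) -[n.+1 in leqRHS]card_ord -cardsT -cardsX.
apply: subset_leq_card; apply/subsetP => _ /imsetP[s + ->].
rewrite !inE /=; apply: leq_trans; apply/bigmax_leqP => A iA.
rewrite -(card_imset _ (@lift_inj _ ord0)).
apply: (@leq_bigmax_cond _ (increasing_on s) (fun A => #|A|)).
apply/forall_inP => _ /imsetP[i Ai ->]; apply/forall_inP => _ /imsetP[j Aj ->].
rewrite !(svalP (perm_lift s)) !ltn_lift.
by move/forall_inP: iA => /(_ i Ai)/forall_inP/(_ j Aj).
Qed.

(** * The determinant counting standard tableaux *)

Section Determinant.

Local Open Scope ring_scope.

(** 1 / (a - b)!, understood as 0 when a < b: the subtraction of naturals would
    give 1 there, and the determinants below need the zeros. *)
Definition inv_fact (R : numFieldType) (a b : nat) : R :=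
  if (b <= a)%N then ((a - b)`!)%:R^-1 else 0.

(** For h_j = c_j + l - 1 - j this is the Schur function of the transpose of the
    partition with column lengths c, in its exponential specialization, that is,
    the number of standard tableaux of this shape over the factorial of the
    number of boxes (Jacobi-Trudi). *)
Definition schur (R : numFieldType) (l : nat) (h : 'I_l -> nat) : R :=
  \det (\matrix_(j < l, q < l) inv_fact R (h j) (rev_ord q)).

Lemma inv_fact_pred (R : numFieldType) (a b : nat) : (0 < a)%N ->
  inv_fact R (a - 1) b = (a%:R - b%:R) * inv_fact R a b.
Proof.
move=> a0; rewrite /inv_fact; case: (ltngtP b a) => ab.
- have h1 : (b <= a - 1)%N by lia.
  have h2 : (a - b = (a - 1 - b).+1)%N by lia.
  rewrite h1 -natrB ?(ltnW ab) // h2 factS natrM invfM mulrA divff ?mul1r //.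
  by rewrite pnatr_eq0.
- have h1 : (b <= a - 1)%N = false by lia.
  by rewrite h1 mulr0.
- have h1 : (b <= a - 1)%N = false by lia.
  by rewrite h1 ab subrr mul0r.
Qed.

(** Removing a box in all possible ways.  Decreasing h_j multiplies the entry in
    row j and column s j by h_j minus its shift; in the Leibniz expansion these
    factors add up to the same number m for every permutation s. *)
Lemma schur_rec (R : numFieldType) (l m : nat) (h : 'I_l -> nat) :
  (\sum_j h j = m + \sum_(q < l) q)%N ->
  m%:R * schur R h =
  \sum_(j < l | (0 < h j)%N) schur R (fun i => (h i - (i == j))%N).
Proof.
move=> Hm; rewrite /schur /determinant exchange_big /= mulr_sumr.
apply: eq_bigr => s _; rewrite -mulr_sumr mulrCA; congr (_ * _).
pose c j : R := (h j)%:R - (rev_ord (s j))%:R.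
have -> : m%:R = \sum_j c j.
  rewrite sumrB -!natr_sum Hm natrD.
  rewrite (_ : \sum_(j < l) rev_ord (s j) = \sum_(q < l) q)%N ?addrK //.
  rewrite [RHS](reindex_inj rev_ord_inj) /=.
  by rewrite [RHS](reindex_inj (@perm_inj _ s)).
rewrite mulr_suml [RHS]big_mkcond /=; apply: eq_bigr => j _.
rewrite (bigD1 j) //= mxE.
case: (posnP (h j)) => hj.
  rewrite /c hj /inv_fact leqn0.
  case: eqP => [E|_]; last by rewrite mul0r mulr0.
  by rewrite [nat_of_ord _]E subrr mul0r.
rewrite [in RHS](bigD1 j) //= !mxE eqxx /= inv_fact_pred // mulrA; congr (_ * _).
by apply: eq_bigr => i /negbTE ij; rewrite !mxE ij subn0.
Qed.

Lemma schur_eq0 (R : numFieldType) (l : nat) (h : 'I_l -> nat) (i j : 'I_l) :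
  i != j -> h i = h j -> schur R h = 0.
Proof.
by move=> ij E; apply: (determinant_alternate ij) => q; rewrite !mxE E.
Qed.

Lemma schur_start (R : numFieldType) (l : nat) : schur R (@rev_ord l) = 1.
Proof.
rewrite /schur -det_tr det_trig; last first.
  apply/is_trig_mxP => q j jq; rewrite !mxE /inv_fact ifF //=.
  by have := ltn_ord j; have := ltn_ord q; lia.
by rewrite big1 // => i _; rewrite !mxE /inv_fact leqnn subnn invr1.
Qed.

(** Passing from one monic family to another is a unitriangular change of
    columns. *)
Lemma det_monic (R : comUnitRingType) (l : nat) (P : nat -> {poly R})
    (x : 'I_l -> R) :
  (forall q, P q \is monic) -> (forall q, size (P q) = q.+1) ->
  \det (\matrix_(j < l, q < l) (P q).[x j]) =
  \det (\matrix_(j < l, q < l) x j ^+ q).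
Proof.
move=> mP sP.
rewrite (_ : \matrix_(j, q) (P q).[x j] =
  (\matrix_(j < l, i < l) x j ^+ i) *m (\matrix_(i < l, q < l) (P q)`_i)).
  rewrite det_mulmx -[X in _ * X]det_tr [X in _ * X]det_trig; last first.
    by apply/is_trig_mxP => q i qi; rewrite !mxE nth_default // sP.
  rewrite [X in _ * X]big1 ?mulr1 // => i _; rewrite !mxE.
  by have := monicP (mP i); rewrite lead_coefE sP.
apply/matrixP => j q; rewrite !mxE.
rewrite (@horner_coef_wide _ l) ?sP ?ltn_ord //.
by apply: eq_bigr => i _; rewrite !mxE mulrC.
Qed.

Lemma schur_ffact (R : numFieldType) (l : nat) (h : 'I_l -> nat) :
  (\prod_j (h j)`!%:R * schur R h) ^+ 2 =
  (\det (\matrix_(j < l, q < l) ((h j) ^_ q)%:R : 'M[R]_l)) ^+ 2.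
Proof.
pose s : 'S_l := perm (@rev_ord_inj l).
have -> : \prod_j (h j)`!%:R * schur R h =
  \det (col_perm s (\matrix_(j < l, q < l) ((h j) ^_ q)%:R : 'M[R]_l)).
  have -> : \prod_j (h j)`!%:R = \det (diag_mx (\row_j (h j)`!%:R)) :> R.
    by rewrite det_diag; apply: eq_bigr => j _; rewrite mxE.
  rewrite /schur -det_mulmx; congr (\det _); apply/matrixP => j q.
  rewrite mul_diag_mx !mxE permE /inv_fact; case: leqP => hq; last first.
    by rewrite ffact_small // mulr0.
  by rewrite -(ffact_fact hq) natrM mulfK // pnatr_eq0 -lt0n fact_gt0.
by rewrite col_permE det_mulmx det_perm exprMn sqrr_sign mulr1.
Qed.

End Determinant.

Definition collen (B : nat) (r : nat -> nat) (j : nat) : nat := \sum_(k < B) (j < r k).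

(** Conjugation of partitions as a Galois connection; with it, all facts on
    column lengths reduce to facts on row lengths. *)
Lemma ltn_collen B r k j : (forall k, r k.+1 <= r k) -> r B = 0 ->
  (k < collen B r j) = (j < r k).
Proof.
elim: B r k => [|B IH] r k mono rB.
  rewrite /collen big_ord0; apply/esym/negbTE; rewrite -leqNgt.
  by elim: k => [|k IH]; [rewrite rB | apply: leq_trans (mono k) IH].
rewrite /collen big_ord_recl /=.
have /= := IH (fun k => r k.+1) _ (fun k => mono k.+1) rB.
rewrite -[\sum_(i < B) _]/(collen B (fun k => r k.+1) j) => {}IH.
have le0 : forall k, r k <= r 0.
  by elim=> // i Hi; apply: leq_trans (mono i) Hi.
have IH0 := IH 0; case: (ltnP j (r 0)) => j0 /=.
  by case: k => [|k]; rewrite add1n // ltnS IH.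
have c0 : collen B (fun k => r k.+1) j = 0 by have := le0 1; lia.
by rewrite c0; apply/esym/negbTE; rewrite -leqNgt; apply: leq_trans (le0 k) j0.
Qed.

Lemma eq_schur (R : numFieldType) l (h h' : 'I_l -> nat) :
  h =1 h' -> schur R h = schur R h'.
Proof. by move=> E; congr (determinant _); apply/matrixP => i j; rewrite !mxE E. Qed.

Lemma collen_add B r r' i j : i < B -> (forall k, r' k = r k + (k == i)) ->
  collen B r' j = collen B r j + (j == r i).
Proof.
move=> iB E; rewrite /collen (bigD1 (Ordinal iB)) //= [in RHS](bigD1 (Ordinal iB)) //=.
rewrite (eq_bigr (fun k : 'I_B => (j < r k) : nat)); last first.
  move=> k; rewrite -val_eqE /= => /negbTE ki.
  by rewrite E ki addn0.
by rewrite E eqxx addn1 ltnS addnAC leq_eqVlt; case: ltngtP.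
Qed.

Definition heights (l B : nat) (r : nat -> nat) (j : 'I_l) : nat :=
  (collen B r j + rev_ord j)%N.

(** [schur_rec] in terms of row lengths.  The removable boxes are the ends of the
    rows k with r (k + 1) < r k; a column which does not end in such a box gives
    two equal values of h after the decrease, hence a vanishing determinant. *)
Lemma schur_rows (R : numFieldType) (l B m : nat) (r : nat -> nat) :
  (forall k, r k.+1 <= r k) -> r B = 0 -> r 0 <= l ->
  \sum_(j < l) collen B r j = m ->
  (m%:R * schur R (@heights l B r) =
  \sum_(i < B | (r i.+1 < r i)%N)
     schur R (@heights l B (fun k => (r k - (k == i))%N)))%R.
Proof.
move=> mono rB rl Hm; have colE k j := ltn_collen k j mono rB.
have le0 : forall k, r k <= r 0.
  by elim=> // i Hi; apply: leq_trans (mono i) Hi.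
rewrite (@schur_rec _ _ m); last first.
  rewrite /heights big_split /= Hm; congr (_ + _).
  by rewrite [RHS](reindex_inj rev_ord_inj).
pose S j : R := schur R (fun i => @heights l B r i - (i == j)).
transitivity (\sum_(i < B | (r i.+1 < r i)%N) \sum_(j < l | r i == j.+1) S j)%R; last first.
  apply: eq_bigr => i ri.
  have r0 : 0 < r i by lia.
  have jl : (r i).-1 < l by have := le0 i; lia.
  rewrite (big_pred1 (Ordinal jl)); last first.
    by move=> j; rewrite /= -[j == _]val_eqE /=; apply/eqP/eqP; lia.
  apply: eq_schur => j; rewrite /heights.
  rewrite (@collen_add B (fun k => r k - (k == i)) r i) //; last first.
    by move=> k; case: eqP => [->|]; lia.
  by rewrite eqxx -val_eqE /= subn1; case: eqP; lia.
rewrite [RHS](exchange_big_dep xpredT) //= [LHS]big_mkcond /=; apply: eq_bigr => j _.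
case: (pickP (fun i : 'I_B => (r i.+1 < r i) && (r i == j.+1))) => [i Hi|none].
  rewrite (big_pred1 i) => [|k]; last first.
    rewrite /=; case: (eqVneq k i) => [->|ki] //; apply/negbTE; apply: contra ki.
    case/andP: Hi => h1 /eqP h2 /andP[h3 /eqP h4]; apply/eqP/val_inj => /=.
    have := colE i j; have := colE k j; have := colE i.+1 j; have := colE k.+1 j.
    by lia.
  rewrite ifT // /heights; case/andP: Hi => _ /eqP Hi.
  by have := colE i j; rewrite Hi ltnSn; lia.
rewrite big_pred0 //; case: ltnP => // hj.
suff [j1 E] : {j1 : 'I_l | j1 = j.+1 :> nat & collen B r j1 = collen B r j}.
  move=> E'; apply: (@schur_eq0 _ _ _ j1 j).
    by rewrite -val_eqE /= E; lia.
  rewrite eqxx -val_eqE /= E (gtn_eqF (ltnSn j)) subn0 /heights E' /=.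
  have := ltn_ord j1; lia.
case: (posnP (collen B r j)) => [c0|c0].
  have jl : j.+1 < l by move: hj; rewrite /heights c0 /=; have := ltn_ord j; lia.
  exists (Ordinal jl) => //=; have := colE 0 j; have := colE 0 j.+1; lia.
have cB : (collen B r j).-1 < B.
  have := colE (collen B r j).-1 j; have := colE B j; rewrite rB; lia.
have := none (Ordinal cB) => /=; set i := (collen B r j).-1.
have i1 : i.+1 = collen B r j by rewrite /i; lia.
rewrite i1; have := colE i j; have := colE i.+1 j; rewrite i1 ltnn leqnn => h1 h2 h3.
have jl : j.+1 < l by have := le0 i; lia.
exists (Ordinal jl) => //=.
have := colE i j.+1; have := colE i.+1 j.+1; rewrite i1. lia.
Qed.

(** * Counting permutations by shape *)

Lemma lattice_letter w i : lattice w -> 0 < rowlen w i -> i < size w.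
Proof.
elim: w i => //= a w IH i /andP[lw la]; rewrite rowlen_cons.
case: (posnP (rowlen w i)) => [->|/(IH i lw) h _]; last exact: ltnW.
case: (eqVneq a (Some i)) la => // -> /=; case: i => // i h _.
by rewrite ltnS; apply: IH => //; apply: leq_ltn_trans h.
Qed.

Lemma lattice_rowlen_big w B : lattice w -> size w <= B -> rowlen w B = 0.
Proof.
move=> lw sB; case: (posnP (rowlen w B)) => // /(lattice_letter lw); lia.
Qed.

Lemma lattice_row0 w k : lattice w -> rowlen w k <= rowlen w 0.
Proof.
by move=> lw; elim: k => // k; apply: leq_trans; apply: lattice_rowlen.
Qed.

Lemma sum_collen w l B : lattice w -> size w <= B -> rowlen w 0 <= l ->
  \sum_(j < l) collen B (rowlen w) j = count isSome w.
Proof.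
elim: w => [|a w IH] lw sB wl.
  rewrite big1 // => j _; rewrite /collen big1 // => k _.
have lw' : lattice w by case/andP: lw.
have wl' : rowlen w 0 <= l by move: wl; rewrite rowlen_cons; lia.
have := IH lw' (ltnW sB) wl'; case: a lw wl sB => [i|] lw wl sB /= <-; last first.
  rewrite add0n; apply: eq_bigr => j _.
  by rewrite /collen; apply: eq_bigr => k _; rewrite rowlen_cons.
have ri : rowlen (Some i :: w) i = (rowlen w i).+1 by rewrite rowlen_cons eqxx.
have iB : i < B by apply: leq_trans sB; apply: lattice_letter => //; rewrite ri.
have il : rowlen w i < l.
  by rewrite -ri; apply: leq_trans wl; apply: lattice_row0.
rewrite (eq_bigr (fun j : 'I_l => collen B (rowlen w) j + (j == rowlen w i :> nat))).
  rewrite big_split /= addnC; congr (_ + _).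
  rewrite (bigD1 (Ordinal il)) //= eqxx big1 ?addn0 // => j.
  by rewrite -val_eqE /= => /negbTE ->.
move=> j _; apply: collen_add => // k.
by rewrite rowlen_cons eqSome eq_sym addnC.
Qed.

Lemma eq_heights l B r r' : r =1 r' -> @heights l B r =1 @heights l B r'.
Proof.
by move=> E j; rewrite /heights /collen; congr (_ + _); apply: eq_bigr => k _; rewrite E.
Qed.

Definition RS_fiber (n m : nat) (w : seq (option nat)) : {set m.-tuple 'I_n} :=
  [set t : m.-tuple 'I_n | uniq t && (RS n (map val t) == w)].

Lemma RS_tuple n m (t : m.-tuple 'I_n) : uniq t ->
  lattice (RS n (map val t)) /\
  forall x, vacant (RS n (map val t)) x = (x < n) && (x \notin map val t).
Proof.
move=> ut; apply: RS_valid; first by rewrite map_inj_uniq //; apply: val_inj.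
by apply/allP => x /mapP[y _ ->]; apply: ltn_ord.
Qed.

(** The last step of the recording tableau is the removable row i from which
    [delete] recovers the last point and the previous word. *)
Lemma RS_fiber_rec n m w : lattice w -> size w = n ->
  #|RS_fiber n m.+1 w| =
  \sum_(i < n.+1 | rowlen w i.+1 < rowlen w i) #|RS_fiber n m (delete w i).1|.
Proof.
move=> lw sw.
pose out (t : m.+1.-tuple 'I_n) :=
  (insert (RS n (map val (behead t))) (thead t)).2.
pose fib := RS_fiber n m.+1 w.
have fibP t : t \in fib -> [/\ uniq (behead t), 
   vacant (RS n (map val (behead t))) (thead t) &
   insert (RS n (map val (behead t))) (thead t) = (w, out t)].
  rewrite inE; case/tupleP: t => x t; rewrite /out theadE /=.
  move=> /andP[/andP[xt ut] /eqP <-]; split => //; last by case: (insert _ _).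
  have [_ ->] := RS_tuple ut; rewrite ltn_ord /= mem_map //; exact: val_inj.
have outP t : t \in fib -> (out t < n.+1) && (rowlen w (out t).+1 < rowlen w (out t)).
  move=> /fibP[ut fx E].
  have [lt' _] := @RS_tuple _ _ [tuple of behead t] ut.
  have := rowlen_insert (out t) fx; have := rowlen_insert (out t).+1 fx.
  rewrite E /= eqxx (gtn_eqF (ltnSn _)) addn0 addn1.
  have := lattice_rowlen (out t) lt' => /= h1 h2 h3.
  have h4 : rowlen w (out t).+1 < rowlen w (out t) by rewrite h2 h3 ltnS.
  rewrite h4 andbT ltnS -sw ltnW //; apply: lattice_letter => //; lia.
rewrite -sum1_card (partition_big (fun t => inord (out t) : 'I_n.+1)
   (fun i : 'I_n.+1 => rowlen w i.+1 < rowlen w i)) /=; last first.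
  by move=> t /outP/andP[h1 h2]; rewrite inordK.
apply: eq_bigr => i ri; rewrite sum1dep_card.
have [fv lv iv] := insert_delete lw ri.
set v := (delete w i).1 in fv lv iv *; set x := (delete w i).2 in fv iv.
have sv : size v = n by rewrite -sw -[w]/((w, nat_of_ord i).1) -iv size_insert.
have xn : x < n by rewrite -sv; apply: vacant_size.
pose f (t : m.-tuple 'I_n) := [tuple of Ordinal xn :: t].
rewrite -(card_imset _ (_ : injective f)); last first.
  by move=> t t' /(congr1 (@behead _ \o val)) /= E; apply: val_inj.
apply: eq_card => t; apply/idP/imsetP.
  rewrite !inE => /andP[tf /eqP Ei].
  have {}tf : t \in fib by rewrite inE.
  have [ut fx E] := fibP t tf.
  have /andP[on _] := outP t tf.
  have oi : out t = i by rewrite -Ei inordK.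
  exists [tuple of behead t].
    rewrite inE /= ut /=; apply/eqP.
    by have := delete_insert fx; rewrite E oi /= /v => ->.
  have := delete_insert fx; rewrite E oi /= => Ed.
  rewrite [LHS]tuple_eta; apply: val_inj => /=; congr (_ :: _).
  by apply: val_inj; rewrite /= /x Ed.
move=> [t' /[!inE] /andP[ut /eqP Et] ->].
have [_ fE] := RS_tuple ut.
rewrite /out /f theadE /= ut Et iv /= eqxx andbT.
have := fE x; rewrite Et fv => /esym/andP[_ xt].
apply/andP; split; last by apply/eqP/val_inj; rewrite /= inordK.
by rewrite andbT; apply: contra xt => xt; apply/mapP; exists (Ordinal xn).
Qed.

Lemma schur_empty (R : numFieldType) l B (r : nat -> nat) :
  (forall k, r k = 0) -> schur R (@heights l B r) = 1%R.
Proof.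
move=> r0; rewrite -(schur_start R l); apply: eq_schur => j.
by rewrite /heights /collen big1 // => k _; rewrite r0.
Qed.

(** The number of recording tableaux of a given shape: both sides satisfy the
    recursion over removable boxes. *)
Lemma card_RS_fiber (R : numFieldType) n l m w :
  lattice w -> size w = n -> count isSome w = m -> rowlen w 0 <= l ->
  (#|RS_fiber n m w|%:R = m`!%:R * schur R (@heights l n.+1 (rowlen w)))%R.
Proof.
elim: m w => [|m IH] w lw sw cw wl.
  have Ew : w = nseq n None.
    rewrite -sw; elim: (w) cw => //= -[i|] u IHu //= cu; congr (_ :: _); exact: IHu.
  rewrite schur_empty; last by move=> k; rewrite Ew /rowlen count_nseq.
  rewrite mulr1; congr (_%:R)%R.
  rewrite (_ : RS_fiber n 0 w = [set [tuple]]) ?cards1 ?fact0 //.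
  by apply/setP => t; rewrite !inE tuple0 /= Ew !eqxx.
rewrite RS_fiber_rec // natr_sum factS natrM mulrAC.
rewrite (@schur_rows _ _ _ m.+1) //; last 3 first.
- by move=> k; apply: lattice_rowlen.
- by apply: lattice_rowlen_big => //; rewrite sw.
- by rewrite sum_collen // sw.
rewrite mulr_suml; apply: eq_bigr => i ri; rewrite mulrC.
have [fv lv iv] := insert_delete lw ri.
set v := (delete w i).1 in fv lv iv *.
have rE k : rowlen w k = rowlen v k + (k == i).
  by rewrite -[w]/((w, nat_of_ord i).1) -iv rowlen_insert // iv.
have sv : size v = n by rewrite -sw -[w]/((w, nat_of_ord i).1) -iv size_insert.
have vl : rowlen v 0 <= l by rewrite rE in wl; lia.
rewrite IH //.
  congr (_ * _)%R; apply: eq_schur; apply: eq_heights => k.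
  by rewrite rE addnK.
rewrite -(@sum_collen v l n.+1) ?sv //.
have := sum_collen lw _ wl => /(_ n.+1); rewrite sw cw => /(_ (leqnSn n)).
have il : rowlen v i < l.
  have := leq_trans (lattice_row0 i lw) wl; rewrite rE eqxx; lia.
rewrite (eq_bigr (fun j : 'I_l => collen n.+1 (rowlen v) j + (j == rowlen v i :> nat))).
  rewrite big_split /= (bigD1 (Ordinal il)) //= [X in _ + X](bigD1 (Ordinal il)) //= eqxx.
  rewrite [X in _ + (_ + X)]big1 ?addn0; first by rewrite addn1 => -[].
  by move=> j; rewrite -val_eqE /= => /negbTE ->.
by move=> j _; apply: collen_add.
Qed.

Definition word_of B m (p : m.-tuple 'I_B) : seq (option nat) :=
  [seq Some (val i) | i <- p].

Lemma isSome_word B m (p : m.-tuple 'I_B) : count isSome (word_of p) = m.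
Proof.
rewrite /word_of count_map (eq_count (a2 := predT)) // count_predT.
exact: size_tuple.
Qed.

Lemma size_word B m (p : m.-tuple 'I_B) : size (word_of p) = m.
Proof. by rewrite size_map size_tuple. Qed.

Definition words (B m : nat) (r : nat -> nat) : {set m.-tuple 'I_B} :=
  [set p : m.-tuple 'I_B | lattice (word_of p) &&
           [forall k : 'I_B, rowlen (word_of p) k == r k]].

Lemma rowlen_word_big B m (p : m.-tuple 'I_B) k : B <= k -> rowlen (word_of p) k = 0.
Proof.
move=> Bk; apply/count_memPn; apply/mapP => -[i _ [E]].
by have := ltn_ord i; rewrite -E; lia.
Qed.

(** The number of insertion tableaux of a given shape, by the same recursion: the
    last letter of a lattice word is a removable row. *)
Lemma card_words (R : numFieldType) B l m (r : nat -> nat) :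
  (forall k, r k.+1 <= r k) -> r B = 0 -> r 0 <= l ->
  \sum_(j < l) collen B r j = m ->
  (#|words B m r|%:R = m`!%:R * schur R (@heights l B r))%R.
Proof.
elim: m r => [|m IH] r mono rB rl Hm.
  have colE k j := ltn_collen k j mono rB.
  have r0 k : r k = 0.
    have le0 : r k <= r 0 by elim: k => // k; apply: leq_trans.
    suff : r 0 = 0 by lia.
    case: l rl Hm => [|l] rl; first lia.
    rewrite big_ord_recl /= => /eqP; rewrite addn_eq0 => /andP[/eqP c0 _].
    have := colE 0 0; rewrite c0; lia.
  rewrite schur_empty // mulr1; congr (_%:R)%R.
  rewrite (_ : words B 0 r = [set [tuple]]) ?cards1 ?fact0 //.
  apply/setP => t; rewrite !inE tuple0 /= [RHS]eqxx.
  by apply/forallP => k; rewrite r0.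
rewrite factS natrM mulrAC (@schur_rows _ _ _ m.+1) //.
rewrite -sum1_card (partition_big (fun t => thead t) (fun i : 'I_B => r i.+1 < r i)) /=.
  rewrite natr_sum mulr_suml; apply: eq_bigr => i ri; rewrite mulrC.
  have colE k j := ltn_collen k j mono rB.
  pose r' k := r k - (k == i).
  have mono' k : r' k.+1 <= r' k.
    rewrite /r'; have := mono k; case: (eqVneq k i) => [->|]; lia.
  have rE k : r k = r' k + (k == i) by rewrite /r'; case: eqP => [->|]; lia.
  rewrite -IH; first last.
  - have il : r' i < l.
      have : r i <= r 0 by elim: (nat_of_ord i) => // k; apply: leq_trans.
      rewrite /r' eqxx; lia.
    apply/eqP; rewrite -eqSS -Hm.
    rewrite [X in _ == X](eq_bigr (fun j : 'I_l => collen B r' j + (j == r' i :> nat))).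
      rewrite big_split /= [X in _ == _ + X](bigD1 (Ordinal il)) //= eqxx.
      rewrite [X in _ == _ + (_ + X)]big1 ?addn0 ?addn1 //.
      by move=> j; rewrite -val_eqE /= => /negbTE ->.
    by move=> j _; apply: collen_add.
  - by rewrite /r'; lia.
  - by rewrite /r' rB.
  - exact: mono'.
  rewrite sum1dep_card; congr (_%:R)%R.
  pose f (t : m.-tuple 'I_B) := [tuple of i :: t].
  rewrite -(card_imset (words B m r') (_ : injective f)); last first.
    by move=> t t' /(congr1 (@behead _ \o val)) /= E; apply: val_inj.
  apply: eq_card => t; rewrite inE; apply/idP/imsetP.
    case/tupleP: t => x t; rewrite !inE theadE => /andP[/andP[lt /forallP Hr] /eqP xi].
    exists t; last by rewrite /f xi.
    have lt' : lattice (word_of t) by case/andP: lt.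
    rewrite inE lt' /=; apply/forallP => k.
    have := Hr k; rewrite rowlen_cons rE xi eqSome (eq_sym (i : nat)) addnC eqn_add2r //.
  move=> [t' /[!inE] /andP[lt /forallP Hr] ->].
  rewrite /f theadE eqxx andbT.
  have {}Hr k : rowlen (word_of t') k = r' k.
    case: (ltnP k B) => kB; first by apply/eqP; have := Hr (Ordinal kB).
    rewrite rowlen_word_big // /r'; have : r k <= r B.
      by rewrite -(subnK kB); elim: (k - B) => // d; apply: leq_trans; rewrite addSn.
    lia.
  apply/andP; split; last first.
    by apply/forallP => k; rewrite rowlen_cons Hr rE eqSome (eq_sym (nat_of_ord i)) addnC.
  rewrite /= -/(word_of t') lt /=; case E: (nat_of_ord i) => [|k] //.
  rewrite !Hr /r' E eqxx; rewrite E in ri; have := mono k; lia.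
move=> t; case/tupleP: t => x t; rewrite inE theadE => /andP[lt /forallP Hr].
have {}Hr k : rowlen (word_of [tuple of x :: t]) k = r k.
  case: (ltnP k B) => kB; first by apply/eqP; have := Hr (Ordinal kB).
  rewrite rowlen_word_big //; have : r k <= r B.
    by rewrite -(subnK kB); elim: (k - B) => // d; apply: leq_trans; rewrite addSn.
  lia.
rewrite -!Hr !rowlen_cons !eqSome eqxx (ltn_eqF (ltnSn _)).
by case/andP: lt => lt _; have := lattice_rowlen x lt; rewrite -/(word_of t); lia.
Qed.

Lemma all_isSome w : (forall x, x < size w -> ~~ vacant w x) -> all isSome w.
Proof.
elim: w => //= a w IH H; apply/andP; split.
  by have := H (size w) (ltnSn _); rewrite eqxx; case: a {H}.
apply: IH => x xw; have := H x (ltnW xw).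
by rewrite (ltn_eqF xw).
Qed.

(** The list of a permutation is reversed because [RS] reads lists from the
    end. *)
Lemma rev_word n (s : 'S_n) : exists2 f : nat -> nat,
  (forall i : 'I_n, f i = s i :> nat) &
  map val [tuple s (rev_ord i) | i < n] = revseq f n.
Proof.
pose f i := if insub i is Some o then val (s o) else 0.
exists f => [i|]; first by rewrite /f valK.
rewrite /revseq; apply: (@eq_from_nth _ 0) => [|i].
  by rewrite size_rev size_mkseq size_map size_tuple.
rewrite size_map size_tuple => ni.
rewrite nth_rev ?size_mkseq // nth_mkseq; last by lia.
rewrite (nth_map (Ordinal ni)) ?size_tuple //.
rewrite -(tnth_nth _ _ (Ordinal ni)) tnth_mktuple.
by rewrite /f -[(n - i.+1)%N]/(val (rev_ord (Ordinal ni))) valK.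
Qed.

Lemma card_Lmax_tuples n l :
  #|[set s : 'S_n | Lmax s <= l]| =
  #|[set t : n.-tuple 'I_n | uniq t && (rowlen (RS n (map val t)) 0 <= l)]|.
Proof.
pose f (s : 'S_n) := [tuple s (rev_ord i) | i < n].
have finj : injective f.
  move=> s s' E; apply/permP => i.
  have := congr1 (fun t => tnth t (rev_ord i)) E.
  by rewrite !tnth_mktuple rev_ordK.
have uf s : uniq (f s).
  apply/tuple_uniqP => i j; rewrite !tnth_mktuple => /perm_inj.
  exact: rev_ord_inj.
have Lf s : rowlen (RS n (map val (f s))) 0 = Lmax s.
  have [g gE tE] := rev_word s.
  rewrite rowlen0_RS; first by rewrite (Lmax_lis gE) tE.
    by rewrite map_inj_uniq //; apply: val_inj.
  by apply/allP => x /mapP[y _ ->]; apply: ltn_ord.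
rewrite -(card_imset _ finj); apply: eq_card => t; rewrite inE.
apply/imsetP/idP => [[s + ->]|/andP[ut tl]].
  by rewrite inE uf Lf.
have inj : injective (fun i => tnth t (rev_ord i)).
  by move=> i j /(tuple_uniqP _ ut)/rev_ord_inj.
have ft : f (perm inj) = t.
  by apply: eq_from_tnth => i; rewrite tnth_mktuple permE rev_ordK.
by exists (perm inj); rewrite // inE -Lf ft.
Qed.

(** The letters range over n + 1 values so that the type of letters is never
    empty; only letters below n occur in a lattice word of length n. *)
Definition good_words (n l : nat) : {set n.-tuple 'I_n.+1} :=
  [set p | lattice (word_of p) && (rowlen (word_of p) 0 <= l)].

Lemma card_Lmax_words (R : numFieldType) n l :
  (#|[set s : 'S_n | (Lmax s <= l)%N]|%:R =
   \sum_(p in good_words n l)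
     n`!%:R * schur R (@heights l n.+1 (rowlen (word_of p))))%R.
Proof.
rewrite card_Lmax_tuples.
pose pt (t : n.-tuple 'I_n) : n.-tuple 'I_n.+1 :=
  map_tuple (fun a => inord (odflt 0 a))
    (Tuple (introT eqP (size_RS n (map val t)))).
have ptE (t : n.-tuple 'I_n) : uniq t -> word_of (pt t) = RS n (map val t).
  move=> ut; have [lt fE] := RS_tuple ut.
  have aS : all isSome (RS n (map val t)).
    apply: all_isSome => x; rewrite size_RS => xn; rewrite fE xn /= negbK.
    have it : injective (tnth t) by apply/tuple_uniqP.
    have /codomP[y Ey] := inj_card_onto it (leqnn _) (Ordinal xn).
    by rewrite -[x]/(val (Ordinal xn)) Ey map_f // mem_tnth.
  rewrite /word_of /= -map_comp -[RHS]map_id; apply/eq_in_map => a aw /=.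
  case: a aw (allP aS a aw) => //= i iw _; rewrite inordK //.
  have := @lattice_letter _ i lt; rewrite size_RS => H; apply/ltnW/H.
  by rewrite -has_count has_pred1.
rewrite -sum1_card (partition_big pt (mem (good_words n l))) /=; last first.
  move=> t; rewrite !inE => /andP[ut tl]; rewrite ptE // tl andbT.
  by have [] := RS_tuple ut.
rewrite natr_sum; apply: eq_bigr => p; rewrite inE => /andP[lp pl].
rewrite sum1dep_card -(card_RS_fiber R lp) ?size_word ?isSome_word //.
congr (_%:R)%R; apply: eq_card => t; rewrite !inE.
case ut: (uniq t) => //=; apply/andP/eqP => [[_ /eqP <-]|E].
  by rewrite ptE.
split; first by rewrite E.
apply/eqP/val_inj/(inj_map (f := fun i : 'I_n.+1 => Some (val i))).
  by move=> i j [/val_inj].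
by rewrite -[LHS]/(word_of (pt t)) ptE.
Qed.

Lemma card_words_shape (R : numFieldType) n l (p : n.-tuple 'I_n.+1) :
  p \in good_words n l ->
  (#|[set q in good_words n l | [forall j : 'I_l,
     collen n.+1 (rowlen (word_of q)) j == collen n.+1 (rowlen (word_of p)) j]]|%:R
   = n`!%:R * schur R (@heights l n.+1 (rowlen (word_of p))))%R.
Proof.
rewrite inE => /andP[lp pl].
have rB (q : n.-tuple 'I_n.+1) : rowlen (word_of q) n.+1 = 0 by apply: rowlen_word_big.
have colE (q : n.-tuple 'I_n.+1) k j : lattice (word_of q) ->
    (k < collen n.+1 (rowlen (word_of q)) j) = (j < rowlen (word_of q) k).
  by move=> lq; apply: ltn_collen => // i; apply: lattice_rowlen.
rewrite -card_words //; last first.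
- by rewrite sum_collen ?size_word ?isSome_word.
- by move=> k; apply: lattice_rowlen.
congr (_%:R)%R; apply: eq_card => q; rewrite !inE.
case lq: (lattice (word_of q)) => //=.
apply/andP/forallP => [[ql /forallP H] k|H].
  apply/eqP; have Hj j : j < l ->
    (j < rowlen (word_of q) k) = (j < rowlen (word_of p) k).
    by move=> jl; have := H (Ordinal jl) => /eqP /= E; rewrite -!colE // E.
  have := leq_trans (lattice_row0 k lq) ql.
  have := leq_trans (lattice_row0 k lp) pl.
  have := Hj (rowlen (word_of q) k); have := Hj (rowlen (word_of p) k).
  by lia.
have E k : rowlen (word_of q) k = rowlen (word_of p) k.
  case: (ltnP k n.+1) => kn; first by apply/eqP; have := H (Ordinal kn).
  by rewrite !rowlen_word_big.
split; first by rewrite E.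
apply/forallP => j; apply/eqP; rewrite /collen.
by apply: eq_bigr => k _; rewrite E.
Qed.

(** An injective function becomes decreasing after ordering the indices by the
    number of larger values. *)
Lemma sort_inj l (h : 'I_l -> nat) : injective h ->
  exists s : 'S_l, forall i j : 'I_l, i < j -> h (s j) < h (s i).
Proof.
move=> hi.
have [rk rk_lt rk_mono] : exists2 rk : 'I_l -> nat,
    forall j, rk j < l & forall i j, h i < h j -> rk j < rk i.
  exists (fun j => #|[set i | h j < h i]|) => [j|i j hij].
    rewrite -[X in _ < X]card_ord -cardsT; apply: proper_card.
    by rewrite properE subsetT; apply/subsetPn; exists j; rewrite // inE ltnn.
  apply: proper_card; rewrite properE; apply/andP; split.
    by apply/subsetP => k; rewrite !inE; apply: ltn_trans.
  by apply/subsetPn; exists j; rewrite inE // ltnn.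
have rki : injective (fun j => Ordinal (rk_lt j)).
  move=> i j /(congr1 val) /= E; apply: hi.
  by case: (ltngtP (h i) (h j)) => // /rk_mono; rewrite E ltnn.
exists (perm rki)^-1%g => i j ij.
have E k : rk ((perm rki)^-1%g k) = k.
  by rewrite -[in RHS](permKV (perm rki) k) permE.
rewrite ltnNge; apply/negP; rewrite leq_eqVlt => /orP[/eqP/hi/perm_inj ji|/rk_mono].
  by rewrite ji ltnn in ij.
by rewrite !E ltnNge (ltnW ij).
Qed.

Lemma decreasing_ge l (h : 'I_l -> nat) (j : 'I_l) :
  (forall i j : 'I_l, i < j -> h j < h i) -> rev_ord j <= h j.
Proof.
move=> dec; have [d] := ubnP (rev_ord j : nat); elim: d j => // d IH j /= jd.
case: (ltnP j.+1 l) => jl; last by lia.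
have := IH (Ordinal jl); have := dec j (Ordinal jl) (ltnSn j) => /=; lia.
Qed.

Lemma sum_inj_ge l (h : 'I_l -> nat) : injective h ->
  \sum_(q < l) q <= \sum_j h j.
Proof.
case/sort_inj => s ds; rewrite (reindex_inj rev_ord_inj) /=.
rewrite [X in _ <= X](reindex_inj (@perm_inj _ s)) /=.
by apply: leq_sum => j _; apply: (decreasing_ge (h := fun j => h (s j))).
Qed.

Local Open Scope ring_scope.

Lemma good_sum n l (p : n.-tuple 'I_n.+1) : p \in good_words n l ->
  (\sum_j @heights l n.+1 (rowlen (word_of p)) j = n + \sum_(q < l) q)%N.
Proof.
rewrite inE => /andP[lp pl]; rewrite /heights big_split /=.
rewrite sum_collen ?size_word ?isSome_word //; congr (_ + _)%N.
by rewrite [RHS](reindex_inj rev_ord_inj).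
Qed.

(** A shape is determined by its l column lengths, each at most n, so there are
    at most (n + 2) ^ l shapes; K bounds the density of tableaux of each. *)
Lemma card_Lmax_upper (R : realFieldType) n l (K : R) : 0 <= K ->
  (forall h : 'I_l -> nat, (\sum_j h j = n + \sum_(q < l) q)%N -> schur R h <= K) ->
  #|[set s : 'S_n | (Lmax s <= l)%N]|%:R <= n.+2%:R ^+ l * (n`!%:R * K) ^+ 2.
Proof.
move=> K0 HK; rewrite card_Lmax_words.
pose sh (p : n.-tuple 'I_n.+1) : {ffun 'I_l -> 'I_n.+2} :=
  [ffun j : 'I_l => inord (collen n.+1 (rowlen (word_of p)) j)].
have shK p j : sh p j = collen n.+1 (rowlen (word_of p)) j :> nat.
  rewrite ffunE inordK // ltnS /collen -[X in (_ <= X)%N]muln1 -[X in (_ <= X * _)%N]card_ord.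
  by rewrite -sum_nat_const; apply: leq_sum => k _; apply: leq_b1.
have F0 : 0 <= n`!%:R * K by rewrite mulr_ge0.
have cG : #|good_words n l|%:R <= n.+2%:R ^+ l * (n`!%:R * K).
  rewrite -sum1_card (partition_big sh xpredT) //= natr_sum.
  have -> : n.+2%:R ^+ l = #|{ffun 'I_l -> 'I_n.+2}|%:R :> R.
    by rewrite card_ffun !card_ord natrX.
  rewrite mulr_natl -sumr_const; apply: ler_sum => c _.
  rewrite sum1dep_card.
  case: (pickP (fun p => (p \in good_words n l) && (sh p == c))) => [p /andP[gp /eqP pc]|none]; last first.
    by rewrite eq_card0 // => p; rewrite inE; apply: none.
  rewrite [X in X%:R](_ : _ = #|[set q in good_words n l | [forall j : 'I_l,
     collen n.+1 (rowlen (word_of q)) j == collen n.+1 (rowlen (word_of p)) j]]|).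
    by rewrite (card_words_shape R gp) ler_wpM2l // HK // good_sum.
  apply: eq_card => q; rewrite !inE; congr (_ && _).
  apply/eqP/forallP => [E j|E]; first by rewrite -!shK E pc.
  rewrite -pc; apply/ffunP => j; apply/val_inj/eqP; rewrite /= !shK; exact: E.
apply: (@le_trans _ _ (\sum_(p in good_words n l) (n`!%:R * K))).
  by apply: ler_sum => p gp; rewrite ler_wpM2l // HK // good_sum.
by rewrite sumr_const -[leLHS]mulr_natl expr2 [X in _ <= X]mulrA ler_wpM2r.
Qed.

Lemma schur_perm (R : numFieldType) l (h : 'I_l -> nat) (s : 'S_l) :
  schur R (fun j => h (s j)) ^+ 2 = schur R h ^+ 2.
Proof.
have -> : schur R (fun j => h (s j)) = \det (row_perm s
   (\matrix_(j < l, q < l) inv_fact R (h j) (rev_ord q))).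
  by congr (\det _); apply/matrixP => i j; rewrite !mxE.
by rewrite row_permE det_mulmx det_perm exprMn sqrr_sign mul1r.
Qed.

(** Any distinct h_j with the right sum belong, after sorting, to a shape with n
    boxes, and the permutations of this shape alone number the square on the
    left. *)
Lemma card_Lmax_lower (R : realFieldType) n l (h : 'I_l -> nat) :
  injective h -> (\sum_j h j = n + \sum_(q < l) q)%N ->
  (n`!%:R * schur R h) ^+ 2 <= #|[set s : 'S_n | (Lmax s <= l)%N]|%:R.
Proof.
move=> hi Hs; have [s ds] := sort_inj hi.
rewrite exprMn -(schur_perm R h s) -exprMn.
have {hi}Hs : (\sum_j h (s j) = n + \sum_(q < l) q)%N.
  by rewrite -Hs [RHS](reindex_inj (@perm_inj _ s)).
pose g j := h (s j); rewrite -[fun j => h (s j)]/g.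
have dec : forall i j : 'I_l, (i < j)%N -> (g j < g i)%N by exact: ds.
have {}Hs : (\sum_j g j = n + \sum_(q < l) q)%N by exact: Hs.
clearbody g; clear ds; move: g dec Hs => g; clear h s; move: g => h dec Hs.
have dec1 (i j : 'I_l) : j = i.+1 :> nat -> (h j < h i)%N.
  by move=> E; apply: dec; rewrite E.
have hrev (j : 'I_l) : (rev_ord j <= h j)%N by apply: decreasing_ge.
pose c k := if insub k is Some o then (h o - @rev_ord l o)%N else 0%N.
have cE (o : 'I_l) : c o = (h o - rev_ord o)%N by rewrite /c valK.
have c0 k : (l <= k)%N -> c k = 0%N by move=> lk; rewrite /c insubF // ltnNge lk.
have cmono k : (c k.+1 <= c k)%N.
  case: (ltnP k.+1 l) => kl; last by rewrite c0.
  rewrite (cE (Ordinal kl)) (cE (Ordinal (ltnW kl))) /=.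
  have := dec1 (Ordinal (ltnW kl)) (Ordinal kl) erefl; lia.
have csum : (\sum_(j < l) c j = n)%N.
  apply/eqP; rewrite -(eqn_add2r (\sum_(q < l) q)) -Hs; apply/eqP.
  rewrite [X in (_ + X)%N](reindex_inj rev_ord_inj) -big_split /=.
  by apply: eq_bigr => j _; rewrite cE subnK // hrev.
pose r k := collen l c k.
have rE k j : (j < r k)%N = (k < c j)%N by apply: ltn_collen => //; apply: c0.
have cn : (c 0 <= n)%N.
  case: (posnP l) => [l0|l0]; first by rewrite c0 ?l0.
  by rewrite -csum (bigD1 (Ordinal l0)) //= leq_addr.
have rmono k : (r k.+1 <= r k)%N.
  have := rE k.+1 (r k); have := rE k (r k); rewrite ltnn; lia.
have rB : r n.+1 = 0%N by have := rE n.+1 0%N; lia.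
have rl : (r 0 <= l)%N by have := rE 0%N l; rewrite c0 //; lia.
have colE j : collen n.+1 r j = c j.
  have H k : (k < collen n.+1 r j)%N = (k < c j)%N by rewrite ltn_collen.
  have := H (c j); have := H (collen n.+1 r j); lia.
have hE : h =1 @heights l n.+1 r.
  by move=> j; rewrite /heights colE cE subnK // hrev.
have csum' : (\sum_(j < l) collen n.+1 r j = n)%N.
  by rewrite -[RHS]csum; apply: eq_bigr => j _; rewrite colE.
have cw := card_words R rmono rB rl csum'.
rewrite (eq_schur R hE) -cw.
have wr p : p \in words n.+1 n r -> lattice (word_of p) /\ rowlen (word_of p) =1 r.
  rewrite inE => /andP[lp /forallP H]; split => // k.
  case: (ltnP k n.+1) => kn; first by apply/eqP; have := H (Ordinal kn).
  have : (r k <= r n.+1)%N.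
    by rewrite -(subnK kn); elim: (k - n.+1)%N => // d; apply: leq_trans; rewrite addSn.
  by rewrite rowlen_word_big //; lia.
rewrite card_Lmax_words (bigID (mem (words n.+1 n r))) /=.
rewrite (eq_bigl (mem (words n.+1 n r))) /=; last first.
  move=> p; apply/andP/idP => [[]//|pw]; split=> //.
  by have [lp pr] := wr p pw; rewrite inE lp pr rl.
rewrite -[leLHS]addr0; apply: lerD; last first.
  by apply: sumr_ge0 => p /andP[gp _]; rewrite -card_words_shape.
rewrite (eq_bigr (fun=> #|words n.+1 n r|%:R)) => [|p /wr[lp pr]]; last first.
  by rewrite cw; congr (_ * _); apply: eq_schur; apply: eq_heights.
by rewrite sumr_const expr2 mulr_natl.
Qed.

From mathcomp Require Import all_classical all_reals all_analysis.
Import numFieldNormedType.Exports.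
Local Open Scope classical_set_scope.

(** * Charlier polynomials *)

(** The monic Charlier polynomials, through the recursion
    c_(k+1)(x) = x c_k(x - 1) - mu c_k(x): the operator on the right is, up to the
    factor mu, the adjoint of the forward difference for the Poisson weight. *)
Fixpoint charlier_poly (R : realType) (mu : R) (k : nat) : {poly R} :=
  if k is k'.+1 then
    (charlier_poly mu k' \Po ('X - 1%:P)) * 'X - mu *: charlier_poly mu k'
  else 1.

Definition charlier (R : realType) (mu : R) (k x : nat) : R :=
  (charlier_poly mu k).[x%:R].

Lemma size_charlier (R : realType) (mu : R) k : size (charlier_poly mu k) = k.+1.
Proof.
elim: k => [|k IH] /=; first by rewrite size_poly1.
have s : size (charlier_poly mu k \Po ('X - 1%:P)) = k.+1.
  by rewrite size_comp_poly2 ?size_XsubC.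
have sX : size ((charlier_poly mu k \Po ('X - 1%:P)) * 'X) = k.+2.
  by rewrite size_mulX ?s // -size_poly_eq0 s.
rewrite size_polyDl sX // size_polyN ltnS.
by rewrite (leq_trans (size_scale_leq _ _)) ?IH.
Qed.

Lemma charlier_monic (R : realType) (mu : R) k : charlier_poly mu k \is monic.
Proof.
elim: k => [|k IH] /=; first exact: monic1.
have s : size (charlier_poly mu k \Po ('X - 1%:P)) = k.+1.
  by rewrite size_comp_poly2 ?size_XsubC // size_charlier.
have sX : size ((charlier_poly mu k \Po ('X - 1%:P)) * 'X) = k.+2.
  by rewrite size_mulX ?s // -size_poly_eq0 s.
rewrite monicE lead_coefDl; last first.
  by rewrite sX size_polyN ltnS (leq_trans (size_scale_leq _ _)) ?size_charlier.
rewrite lead_coefMX lead_coef_comp ?size_XsubC // lead_coefXsubC expr1n mulr1.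
by rewrite -monicE.
Qed.

Lemma charlier0 (R : realType) (mu : R) x : charlier mu 0 x = 1.
Proof. by rewrite /charlier /= hornerC. Qed.

Lemma charlierS (R : realType) (mu : R) k x :
  charlier mu k.+1 x = x%:R * charlier mu k x.-1 - mu * charlier mu k x.
Proof.
rewrite /charlier /= !hornerE horner_comp !hornerE; congr (_ - _).
by case: x => [|x]; rewrite ?mulr0 ?mul0r // mulrC -natr1 addrK.
Qed.

Lemma charlier_diff (R : realType) (mu : R) k x :
  charlier mu k x.+1 = charlier mu k x + k%:R * charlier mu k.-1 x.
Proof.
elim: k x => [|k IH] x; first by rewrite !charlier0 mul0r addr0.
rewrite !charlierS /= !IH.
case: k IH => [|k] IH; first by rewrite !charlier0 -natr1; ring.
have E := charlierS mu k x; apply: subr0_eq.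
transitivity (k.+1%:R * (x%:R * charlier mu k x.-1 - mu * charlier mu k x
              - charlier mu k.+1 x)); last by rewrite -E subrr mulr0.
rewrite {E} /=; case: x => [|x] /=; first by rewrite -!natr1; ring.
rewrite IH /= -!natr1; ring.
Qed.

(** The parameter z may be negative or differ from mu: z = - mu gives the
    alternating sums and z = r mu the exponentially tilted ones. *)
Definition poisson_sum (R : realType) (z : R) (f : nat -> R) (v : R) : Prop :=
  series (fun x => f x * exp_coeff z x) @ \oo --> v.

Lemma poisson_sum1 (R : realType) (z : R) : poisson_sum z (fun=> 1) (expR z).
Proof.
rewrite /poisson_sum (_ : (fun x => _) = exp_coeff z).
  exact: is_cvg_series_exp_coeff.
by apply/funext => x; rewrite mul1r.
Qed.

Arguments poisson_sum1 {R} z.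

Lemma poisson_sum_lin (R : realType) (z a b : R) f g v w :
  poisson_sum z f v -> poisson_sum z g w ->
  poisson_sum z (fun x => a * f x + b * g x) (a * v + b * w).
Proof.
move=> Hf Hg; rewrite /poisson_sum.
have -> : series (fun x => (a * f x + b * g x) * exp_coeff z x) =
   (fun n => a * series (fun x => f x * exp_coeff z x) n +
             b * series (fun x => g x * exp_coeff z x) n).
  apply/funext => n; rewrite /series /= !mulr_sumr -big_split /=.
  by apply: eq_bigr => i _; rewrite mulrDl !mulrA.
by apply: cvgD; apply: cvgMl_tmp.
Qed.

Arguments poisson_sum_lin {R z} a b {f g v w}.

Lemma poisson_sum_shift (R : realType) (z : R) f v :
  poisson_sum z f v -> poisson_sum z (fun x => x%:R * f x.-1) (z * v).
Proof.
move=> Hf; rewrite /poisson_sum -cvg_shiftS.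
have -> : (fun n => series (fun x => x%:R * f x.-1 * exp_coeff z x) n.+1) =
   (fun n => z * series (fun x => f x * exp_coeff z x) n).
  apply/funext => n; rewrite /series /= big_nat_recl // !mul0r add0r mulr_sumr.
  apply: eq_bigr => i _; rewrite /exp_coeff /= factS natrM exprS invfM.
  have : (i.+1%:R : R) != 0 by rewrite pnatr_eq0.
  have : (i`!%:R : R) != 0 by rewrite pnatr_eq0 -lt0n fact_gt0.
  by move: (i.+1%:R) (i`!%:R) => a b b0 a0; field; rewrite a0 b0.
by apply: cvgMl_tmp.
Qed.

Arguments poisson_sum_shift {R z f v}.

Lemma eq_poisson_sum (R : realType) (z : R) f g v :
  poisson_sum z f v -> f =1 g -> poisson_sum z g v.
Proof. by move=> + /funext <-. Qed.

Arguments eq_poisson_sum {R z f g v}.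

(** The Gram matrix of the Charlier polynomials of parameter mu for the weight
    z ^ x / x!, through the recursion that moving one factor of the recursion of
    the first polynomial onto the second one produces. *)
Fixpoint charlier_gram (R : realType) (z mu : R) (k j : nat) : R :=
  if k is k'.+1 then (z - mu) * charlier_gram z mu k' j
                     + z * j%:R * charlier_gram z mu k' j.-1
  else (z - mu) ^+ j * expR z.

Lemma poisson_sum_charlier2 (R : realType) (z mu : R) k j :
  poisson_sum z (fun x => charlier mu k x * charlier mu j x) (charlier_gram z mu k j).
Proof.
elim: k j => [|k IH] j /=.
  suff H : poisson_sum z (charlier mu j) ((z - mu) ^+ j * expR z).
    by apply: eq_poisson_sum H _ => x; rewrite charlier0 mul1r.
  elim: j => [|j IH].
    rewrite expr0 mul1r; apply: (eq_poisson_sum (poisson_sum1 z)) => x.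
    by rewrite charlier0.
  have := poisson_sum_lin 1 (- mu) (poisson_sum_shift IH) IH.
  rewrite exprS -mulrA mulrBl mul1r mulNr => /eq_poisson_sum; apply => x.
  by rewrite charlierS mul1r mulNr.
have H := poisson_sum_lin 1 j%:R (IH j) (IH j.-1).
have := poisson_sum_lin 1 (- mu) (poisson_sum_shift H) (IH j).
rewrite (_ : 1 * _ + _ = (z - mu) * charlier_gram z mu k j
                     + z * j%:R * charlier_gram z mu k j.-1); last by ring.
move=> /eq_poisson_sum; apply => -[|x]; rewrite charlierS /=; first by ring.
by rewrite (charlier_diff mu j x); ring.
Qed.
Arguments poisson_sum_charlier2 {R} z mu k j.

Definition charlier_norm (R : realType) (mu : R) (k : nat) : R :=
  k`!%:R * mu ^+ k * expR mu.

Lemma charlier_norm_gt0 (R : realType) (mu : R) k : 0 < mu -> 0 < charlier_norm mu k.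
Proof.
by move=> mu0; rewrite !mulr_gt0 ?expR_gt0 ?exprn_gt0 // ltr0n fact_gt0.
Qed.

Lemma charlier_gram_diag (R : realType) (mu : R) k j :
  charlier_gram mu mu k j = if k == j then charlier_norm mu k else 0.
Proof.
elim: k j => [|k IH] j /=; rewrite subrr.
  by rewrite expr0n /charlier_norm fact0 mul1r expr0 mul1r; case: j => [|j] /=; rewrite ?mul1r ?mul0r.
rewrite mul0r add0r; case: j => [|j]; first by rewrite mulr0 mul0r.
rewrite IH eqSS; case: eqP => [->|_]; last by rewrite mulr0.
by rewrite /charlier_norm factS natrM exprS /=; ring.
Qed.

(** The Gram matrix for the alternating weight consists of Charlier polynomials
    of parameter 4 mu: both sides satisfy the same recursion in i. *)
Lemma charlier_gram_alt (R : realType) (mu : R) i j :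
  charlier_gram (- mu) mu i j =
  (- (2 * mu)) ^+ j * expR (- mu) * 2 ^- i * charlier (4 * mu) i j.
Proof.
elim: i j => [|i IH] j /=.
  by rewrite charlier0 expr0 invr1 !mulr1; congr (_ ^+ _ * _); ring.
rewrite !IH charlierS exprS invfM.
case: j => [|j] /=; first by rewrite expr0; field; rewrite expf_neq0.
by rewrite exprS; field; rewrite expf_neq0.
Qed.

Lemma exp_coeff_le (R : realType) (x : R) n : 0 <= x -> x ^+ n / n`!%:R <= expR x.
Proof.
move=> x0; case: n => [|n]; last by apply: le_trans (expR_ge1Dxn n x0); rewrite lerDr.
by rewrite expr0 fact0 divr1; apply: le_trans (expR_ge1Dx x); rewrite lerDl.
Qed.

(** A Cauchy estimate in the second index.  The generating function in b of the
    Gram matrix divided by j! mu ^ j is an exponential times a power, and its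
    coefficients alternate in sign, so one coefficient is bounded by the
    whole sum with absolute values; the induction on k proves this directly. *)
Lemma charlier_gram_le (R : realType) (mu r b : R) k j :
  0 < mu -> 0 <= r <= 1 -> 0 < b ->
  `|charlier_gram (r * mu) mu k j| * b ^+ j <=
  j`!%:R * mu ^+ j * expR (r * mu) * expR ((1 - r) * b) *
  ((1 - r) * mu + r * b) ^+ k.
Proof.
move=> mu0 /andP[r0 r1] b0.
have e0 : 0 <= 1 - r by rewrite subr_ge0.
have zE : r * mu - mu = - ((1 - r) * mu) by ring.
elim: k j => [|k IH] j /=; rewrite zE.
  rewrite expr0 mulr1 normrM normrX normrN !ger0_norm ?expR_ge0 ?mulr_ge0 ?(ltW mu0) //.
  have H := exp_coeff_le j (mulr_ge0 e0 (ltW b0)).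
  rewrite ler_pdivrMr ?ltr0n ?fact_gt0 // in H.
  have F : 0 <= mu ^+ j * expR (r * mu) by rewrite mulr_ge0 ?expR_ge0 ?exprn_ge0 ?ltW.
  have := ler_wpM2l F H.
  rewrite (_ : _ * _ ^+ j = ((1 - r) * mu) ^+ j * expR (r * mu) * b ^+ j); last first.
    by rewrite !exprMn; ring.
  by move=> /le_trans; apply; rewrite le_eqVlt; apply/orP; left; apply/eqP; ring.
set Z := expR (r * mu) * expR ((1 - r) * b) * ((1 - r) * mu + r * b) ^+ k.
have IHZ i : `|charlier_gram (r * mu) mu k i| * b ^+ i <= i`!%:R * mu ^+ i * Z.
  by apply: le_trans (IH i) _; rewrite /Z !mulrA.
rewrite (_ : _ * _ ^+ k.+1 = (1 - r) * mu * (j`!%:R * mu ^+ j * Z)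
             + r * b * (j`!%:R * mu ^+ j * Z)); last by rewrite /Z exprS; ring.
apply: (@le_trans _ _ ((1 - r) * mu * (`|charlier_gram (r * mu) mu k j| * b ^+ j)
   + r * mu * j%:R * `|charlier_gram (r * mu) mu k j.-1| * b ^+ j)).
  rewrite !mulrA -mulrDl ler_wpM2r ?exprn_ge0 ?(ltW b0) //.
  apply: le_trans (ler_normD _ _) _; rewrite !normrM normrN !normrM.
  by rewrite (ger0_norm e0) (ger0_norm (ltW mu0)) (ger0_norm r0) normr_nat.
apply: lerD; first by rewrite ler_wpM2l // mulr_ge0 // ltW.
case: j => [|j]; first by rewrite mulr0 !mul0r !mulr_ge0 ?expR_ge0 ?exprn_ge0 ?addr_ge0 ?mulr_ge0 ?(ltW b0) ?(ltW mu0).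
have F : 0 <= r * mu * j.+1%:R * b by rewrite !mulr_ge0 // ltW.
have := ler_wpM2l F (IHZ j) => /=.
rewrite factS natrM !exprS => H.
rewrite (_ : r * mu * _ * _ * _ = r * mu * j.+1%:R * b *
   (`|charlier_gram (r * mu) mu k j| * b ^+ j)); last by ring.
by apply: le_trans H _; rewrite le_eqVlt; apply/orP; left; apply/eqP; ring.
Qed.

Lemma poisson_sum_ge (R : realType) (z : R) f v x :
  0 <= z -> (forall y, 0 <= f y) -> poisson_sum z f v ->
  f x * (z ^+ x / x`!%:R) <= v.
Proof.
move=> z0 f0 Hf.
have u0 y : 0 <= f y * exp_coeff z y.
  by rewrite mulr_ge0 // /exp_coeff /= divr_ge0 // exprn_ge0.
apply: (cvgr_to_ge Hf); near=> n.
have xn : (x < n)%N by near: n; exists x.+1.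
rewrite /series /= (big_cat_nat (n := x)) //= ?(ltnW xn) //.
rewrite (big_ltn (m := x)) // addrCA lerDl addr_ge0 // sumr_ge0 //.
Unshelve. all: by end_near. Qed.

Arguments poisson_sum_ge {R z f v} x.

(** One term of the nonnegative sum for the tilted weight is at most the sum.
    For r < 1 this shows that c_k is small, relative to its norm, left of its
    oscillatory region. *)
Lemma charlier_pointwise (R : realType) (mu r beta : R) k x :
  0 < mu -> 0 <= r <= 1 -> 0 < beta ->
  charlier mu k x ^+ 2 * ((r * mu) ^+ x / x`!%:R) <=
  k`!%:R * mu ^+ k * expR (r * mu) * expR ((1 - r) * (mu * beta)) *
  (r + (1 - r) / beta) ^+ k.
Proof.
move=> mu0 r01 b0; have bm : 0 < mu * beta by rewrite mulr_gt0.
have r0 : 0 <= r by case/andP: r01.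
rewrite expr2.
have H y : 0 <= charlier mu k y * charlier mu k y by rewrite -expr2 sqr_ge0.
apply: le_trans (poisson_sum_ge x (mulr_ge0 r0 (ltW mu0)) H
   (poisson_sum_charlier2 (r * mu) mu k k)) _.
apply: le_trans (ler_norm _) _.
rewrite -(ler_pM2r (exprn_gt0 k bm)).
apply: le_trans (charlier_gram_le k k mu0 r01 bm) _.
rewrite -[leRHS]mulrA -exprMn le_eqVlt; apply/orP; left; apply/eqP.
congr (_ * _ ^+ _); field; exact: lt0r_neq0.
Qed.

Lemma charlier_sqr_le (R : realType) (mu : R) k x : 0 < mu ->
  charlier mu k x ^+ 2 * (mu ^+ x / x`!%:R) <= charlier_norm mu k.
Proof.
move=> mu0; have := @charlier_pointwise R mu 1 1 k x mu0.
by rewrite subrr !mul0r expR0 addr0 expr1n !mul1r !mulr1; apply; rewrite ?ler01 ?lexx.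
Qed.

(** By [charlier_gram_alt] the entry is a Charlier polynomial of parameter 4 mu,
    of degree i and at the argument j.  Its oscillatory region starts at
    (2 sqrt mu - sqrt i) ^ 2, which exceeds j as soon as i and j are less than
    mu, and [charlier_pointwise] applies. *)
Lemma charlier_gram_alt_le (R : realType) (mu kappa : R) i j :
  0 < mu -> 0 < kappa < 1 -> i%:R <= kappa ^+ 2 * mu -> j%:R <= kappa ^+ 2 * mu ->
  charlier_gram (- mu) mu i j ^+ 2 <=
  charlier_norm mu i * charlier_norm mu j * expR (- ((1 - kappa) ^+ 2 * mu)).
Proof.
move=> mu0 /andP[k0 k1] Hi Hj; rewrite charlier_gram_alt.
(* The gain in the exponent is at least eta (4 (1 - kappa) - 4 eta), which this
   eta maximizes. *)
pose eta := (1 - kappa) / 2.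
have e0 : 0 < eta by rewrite /eta; lra.
pose r := (1 + eta)^-1.
have r0 : 0 < r by rewrite invr_gt0; lra.
have r1 : r <= 1 by rewrite invf_le1; lra.
have mu4 : 0 < 4 * mu by lra.
have h2 : 0 < kappa / 2 by lra.
have := @charlier_pointwise R (4 * mu) r (kappa / 2) i j mu4 _ h2.
rewrite (ltW r0) r1 => /(_ isT).
set B := r + _ => H.
have B0 : 0 <= B by apply: addr_ge0; [exact: ltW | apply: divr_ge0; [rewrite subr_ge0 | exact: ltW]].
have eps0 : 0 <= 1 - r by rewrite subr_ge0.
have Bi : B ^+ i <= expR ((1 - r) * (2 * kappa - kappa ^+ 2) * mu).
  apply: (@le_trans _ _ (expR (i%:R * ((1 - r) * (2 / kappa - 1))))).
    rewrite expRM_natl lerXn2r ?nnegrE ?expR_ge0 //.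
    apply: le_trans (expR_ge1Dx _); rewrite /B le_eqVlt; apply/orP; left; apply/eqP.
    by field; rewrite gt_eqF.
  rewrite ler_expR -mulrA mulrCA ler_wpM2l //.
  have F : 0 <= 2 / kappa - 1 by rewrite subr_ge0 ler_pdivlMr //; lra.
  apply: le_trans (ler_wpM2r F Hi) _; rewrite le_eqVlt; apply/orP; left; apply/eqP.
  by field; rewrite gt_eqF.
have rj : r ^- j <= expR (eta * (kappa ^+ 2 * mu)).
  rewrite -exprVn /r invrK; apply: (@le_trans _ _ (expR (j%:R * eta))).
    by rewrite expRM_natl lerXn2r ?nnegrE ?expR_ge0 ?expR_ge1Dx //; lra.
  by rewrite ler_expR mulrC ler_wpM2l // ltW.
have [f0 g0] : (j`!%:R : R) != 0 /\ r != 0.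
  by rewrite pnatr_eq0 -lt0n fact_gt0 gt_eqF.
have -> : ((- (2 * mu)) ^+ j * expR (- mu) * 2 ^- i * charlier (4 * mu) i j) ^+ 2 =
   mu ^+ j * j`!%:R * expR (- (2 * mu)) * 4 ^- i * r ^- j *
   (charlier (4 * mu) i j ^+ 2 * ((r * (4 * mu)) ^+ j / j`!%:R)).
  have -> : expR (- (2 * mu)) = expR (- mu) ^+ 2 by rewrite -expRM_natl; congr expR; ring.
  have -> : (4 : R) = 2 * 2 by ring.
  rewrite exprNn !(exprMn j) !(exprMn i) !exprMn sqrr_sign.
  have : (2 : R) ^+ i != 0 by rewrite expf_neq0.
  have : r ^+ j != 0 by rewrite expf_neq0.
  move: (2 ^+ i) (r ^+ j) f0 => p q f0 q0 p0.
  by field; rewrite f0 q0 p0.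
apply: (@le_trans _ _ (mu ^+ j * j`!%:R * expR (- (2 * mu)) * 4 ^- i * r ^- j *
   (i`!%:R * (4 * mu) ^+ i * expR (r * (4 * mu)) *
      expR ((1 - r) * (4 * mu * (kappa / 2))) * B ^+ i))).
  by rewrite ler_wpM2l // !mulr_ge0 ?exprn_ge0 ?expR_ge0 ?invr_ge0 ?exprn_ge0 ?(ltW mu0) ?(ltW r0).
have -> : charlier_norm mu i * charlier_norm mu j * expR (- ((1 - kappa) ^+ 2 * mu)) =
  mu ^+ j * j`!%:R * i`!%:R * mu ^+ i *
    expR (2 * mu - (1 - kappa) ^+ 2 * mu).
  rewrite /charlier_norm expRD (_ : 2 * mu = mu + mu) 1?expRD; ring.
rewrite (_ : _ * (_ * B ^+ i) = mu ^+ j * j`!%:R * i`!%:R * mu ^+ i *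
  (expR (- (2 * mu)) * expR (r * (4 * mu)) *
      expR ((1 - r) * (4 * mu * (kappa / 2))) * (r ^- j * B ^+ i))); last first.
  by rewrite exprMn; field; rewrite !expf_neq0.
rewrite ler_wpM2l ?mulr_ge0 ?exprn_ge0 ?(ltW mu0) //.
rewrite -!expRD.
apply: le_trans (ler_wpM2l (expR_ge0 _) (ler_pM _ _ rj Bi)) _.
- by rewrite invr_ge0 exprn_ge0 // ltW.
- by rewrite exprn_ge0.
rewrite -!expRD ler_expR.
have er : (1 - r) * (1 + eta) = eta by rewrite /r; field; lra.
have er2 : eta - eta ^+ 2 <= 1 - r.
  rewrite -(ler_pM2r (_ : 0 < 1 + eta)) ?er; last by lra.
  by rewrite -subr_ge0 (_ : _ - _ = eta ^+ 3) ?exprn_ge0 ?(ltW e0) //; ring.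
rewrite -subr_ge0.
have -> : 2 * mu - (1 - kappa) ^+ 2 * mu -
   (- (2 * mu) + r * (4 * mu) + (1 - r) * (4 * mu * (kappa / 2)) +
    (eta * (kappa ^+ 2 * mu) + (1 - r) * (2 * kappa - kappa ^+ 2) * mu)) =
  mu * ((1 - r) * (2 - kappa) ^+ 2 - eta * kappa ^+ 2 - (1 - kappa) ^+ 2) by field.
apply: mulr_ge0; first exact: ltW.
have k2 : 0 <= (2 - kappa) ^+ 2 <= 4.
  by rewrite sqr_ge0 /=; nra.
have := ler_wpM2r (sqr_ge0 (2 - kappa)) er2.
have ek : kappa = 1 - 2 * eta by rewrite /eta; field.
rewrite ek; nra.
Qed.

(** * Mass on the odd integers *)

Lemma charlier_expand (R : realType) (mu : R) k (p : {poly R}) :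
  (size p <= k.+1)%N -> exists2 b : nat -> R, b k = p`_k &
  forall x, p.[x%:R] = \sum_(i < k.+1) b i * charlier mu i x.
Proof.
elim: k p => [|k IH] p sp.
  exists (fun=> p`_0) => // x.
  by rewrite big_ord1 charlier0 mulr1 [in LHS](size1_polyC sp) hornerC.
have sq : (size (p - p`_k.+1 *: charlier_poly mu k.+1)%R <= k.+1)%N.
  apply/leq_sizeP => j; rewrite leq_eqVlt => /orP[/eqP <-|kj].
    rewrite coefB coefZ; have := monicP (charlier_monic mu k.+1).
    by rewrite lead_coefE size_charlier => ->; rewrite mulr1 subrr.
  rewrite coefB coefZ nth_default ?(leq_trans sp) // sub0r.
  by rewrite [(charlier_poly _ _)`_j]nth_default ?mulr0 ?oppr0 // size_charlier.
have [b _ bE] := IH _ sq.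
exists (fun i => if i == k.+1 then p`_k.+1 else b i); first by rewrite eqxx.
move=> x; rewrite big_ord_recr /= eqxx.
rewrite (eq_bigr (fun i : 'I_k.+1 => b i * charlier mu i x)); last first.
  by move=> i _; rewrite ltn_eqF.
by rewrite -bE hornerD hornerN hornerZ -/(charlier mu k.+1 x) subrK.
Qed.

Lemma poisson_sum_sum (R : realType) (z : R) n (a : nat -> R) (f : nat -> nat -> R) (v : nat -> R) :
  (forall i, poisson_sum z (f i) (v i)) ->
  poisson_sum z (fun x => \sum_(i < n) a i * f i x) (\sum_(i < n) a i * v i).
Proof.
move=> H; elim: n => [|n IH].
  have := poisson_sum_lin 0 0 (poisson_sum1 z) (poisson_sum1 z).
  rewrite !mul0r addr0 big_ord0 => /eq_poisson_sum; apply => x.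
  by rewrite ?mul0r ?addr0 ?big_ord0.
have := poisson_sum_lin 1 (a n) IH (H n).
rewrite big_ord_recr mul1r => /eq_poisson_sum; apply => x.
by rewrite big_ord_recr mul1r.
Qed.
Arguments poisson_sum_sum {R z} n a {f v}.

Lemma poisson_sum_sqr (R : realType) (z mu : R) n (b : nat -> R) :
  poisson_sum z (fun x => (\sum_(i < n) b i * charlier mu i x) ^+ 2)
    (\sum_(i < n) \sum_(j < n) b i * b j * charlier_gram z mu i j).
Proof.
have H i := poisson_sum_sum n b (fun j => poisson_sum_charlier2 z mu i j).
have := poisson_sum_sum n b H.
rewrite (eq_bigr (fun i : 'I_n => \sum_(j < n) b i * b j * charlier_gram z mu i j)).
  move=> /eq_poisson_sum; apply => x; rewrite expr2 mulr_suml.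
  apply: eq_bigr => i _; rewrite !mulr_sumr.
  by apply: eq_bigr => j _; ring.
by move=> i _; rewrite mulr_sumr; apply: eq_bigr => j _; rewrite mulrA.
Qed.
Arguments poisson_sum_sqr {R} z mu n b.

(** The geometric mean is at most the arithmetic mean; in this form it needs no
    square roots. *)
Lemma norm_le_mean (R : realType) (X d p q : R) : 0 <= d -> 0 <= p -> 0 <= q ->
  X ^+ 2 <= d ^+ 2 * (p * q) -> X <= d * (p + q) / 2.
Proof.
move=> d0 p0 q0 H.
have D0 : 0 <= d * (p + q) / 2 by rewrite divr_ge0 // mulr_ge0 // addr_ge0.
apply: le_trans (ler_norm _) _; rewrite -(ler_pXn2r (n := 2)) ?nnegrE //.
rewrite real_normK ?num_real //; apply: le_trans H _.
rewrite -subr_ge0 (_ : _ - _ = (d * (p - q) / 2) ^+ 2) ?sqr_ge0 //.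
by field.
Qed.

(** The sum of p ^ 2 mu ^ x / x! over the odd x is half the difference of the full
    and the alternating sums.  The full sum P is at least the norm of the
    Charlier polynomial of degree k because p is monic, and the alternating sum
    is at most P / 2 by [charlier_gram_alt_le].  The geometric weights in rho
    turn a lower bound on an infinite sum into one on a single term. *)
Lemma odd_mass (R : realType) (mu kappa rho : R) k l (p : {poly R}) :
  0 < mu -> 0 < kappa < 1 -> l%:R <= kappa ^+ 2 * mu ->
  l%:R * expR (- ((1 - kappa) ^+ 2 * mu) / 2) <= 1 / 2 ->
  (k < l)%N -> p \is monic -> size p = k.+1 -> 0 < rho < 1 ->
  exists h : nat, charlier_norm mu k / 4 * ((1 - rho) * rho ^+ h.*2.+1) <=
    p.[h.*2.+1%:R] ^+ 2 * (mu ^+ h.*2.+1 / (h.*2.+1)`!%:R).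
Proof.
move=> mu0 k01 lk ld kl mp sp /andP[r0 r1].
have [b bk bE] := @charlier_expand R mu k p (eq_leq sp).
have {}bk : b k = 1 by rewrite bk; have := monicP mp; rewrite lead_coefE sp.
set d := expR (- ((1 - kappa) ^+ 2 * mu) / 2) in ld.
have d0 : 0 <= d by apply: expR_ge0.
have N0 i : 0 < charlier_norm mu i by apply: charlier_norm_gt0.
pose q i := b i ^+ 2 * charlier_norm mu i.
have q0 i : 0 <= q i by rewrite mulr_ge0 ?sqr_ge0 // ltW.
pose P := \sum_(i < k.+1) q i.
have Pk : charlier_norm mu k <= P.
  rewrite /P big_ord_recr /= {2}/q bk expr1n mul1r lerDr sumr_ge0 //.
have H1 := poisson_sum_sqr mu mu k.+1 b.
have H2 := poisson_sum_sqr (- mu) mu k.+1 b.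
have E1 : \sum_(i < k.+1) \sum_(j < k.+1) b i * b j * charlier_gram mu mu i j = P.
  apply: eq_bigr => i _; rewrite (bigD1 i) //= charlier_gram_diag eqxx big1 ?addr0 //.
  by move=> j ji; rewrite charlier_gram_diag [_ == _]eq_sym [_ == _](negbTE ji) mulr0.
set A := \sum_(i < k.+1) _ in H2.
(* Each entry is at most d times the geometric mean of the two norms, and
   l d <= 1 / 2. *)
have AP : A <= P / 2.
  apply: (@le_trans _ _ (\sum_(i < k.+1) \sum_(j < k.+1) d * (q i + q j) / 2)).
    apply: ler_sum => i _; apply: ler_sum => j _.
    apply: norm_le_mean => //.
    have ik : i%:R <= kappa ^+ 2 * mu.
      by apply: le_trans lk; rewrite ler_nat; have := ltn_ord i; lia.
    have jk : j%:R <= kappa ^+ 2 * mu.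
      by apply: le_trans lk; rewrite ler_nat; have := ltn_ord j; lia.
    have := charlier_gram_alt_le mu0 k01 ik jk.
    have F : 0 <= (b i * b j) ^+ 2 by apply: sqr_ge0.
    move=> /(ler_wpM2l F); rewrite -exprMn => /le_trans; apply.
    have -> : d ^+ 2 = expR (- ((1 - kappa) ^+ 2 * mu)).
      by rewrite /d -expRM_natl; congr expR; field.
    by rewrite /q le_eqVlt; apply/orP; left; apply/eqP; ring.
  have -> : \sum_(i < k.+1) \sum_(j < k.+1) d * (q i + q j) / 2 = d * k.+1%:R * P.
    transitivity (\sum_(i < k.+1) (d / 2) * (k.+1%:R * q i + P)).
      apply: eq_bigr => i _.
      rewrite (eq_bigr (fun j : 'I_k.+1 => d / 2 * (q i + q j))).
        by rewrite -mulr_sumr big_split /= sumr_const card_ord mulr_natl.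
      by move=> j _; rewrite mulrAC.
    rewrite -mulr_sumr big_split /= -mulr_sumr -/P sumr_const card_ord -mulr_natl.
    by field.
  have P0 : 0 <= P by apply: le_trans Pk; apply: ltW.
  rewrite mulrC ler_wpM2l //; apply: le_trans (_ : l%:R * d <= _); last by lra.
  by rewrite mulrC ler_wpM2r // ler_nat.
apply: contrapT => /forallNP none.
pose u x := p.[x%:R] ^+ 2 * (exp_coeff mu x - exp_coeff (- mu) x).
have cu : series u @ \oo --> P - A.
  rewrite -E1; have -> : series u =
     (fun n => series (fun x => (\sum_(i < k.+1) b i * charlier mu i x) ^+ 2 * exp_coeff mu x) n
       - series (fun x => (\sum_(i < k.+1) b i * charlier mu i x) ^+ 2 * exp_coeff (- mu) x) n).
    apply/funext => n; rewrite /series /= -sumrB; apply: eq_bigr => x _.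
    by rewrite /u bE mulrBr.
  exact: cvgB H1 H2.
pose N := charlier_norm mu k.
(* Only odd x contribute.  As x = 0 is not among them, the geometric weights sum
   to at most rho < 1, which contradicts the limit. *)
have ub n : series u n.+1 <= N / 2 * (rho - rho ^+ n.+1).
  elim: n => [|n IH].
    rewrite /series /= big_nat1 /u /exp_coeff /= !expr0 subrr mulr0.
    by rewrite expr1 subrr mulr0.
  have -> : series u n.+2 = series u n.+1 + u n.+1.
    by rewrite /series /= big_nat_recr.
  have -> : N / 2 * (rho - rho ^+ n.+2) =
     N / 2 * (rho - rho ^+ n.+1) + N / 2 * ((1 - rho) * rho ^+ n.+1).
    by rewrite [rho ^+ n.+2]exprS; ring.
  apply: lerD => //; have F : 0 <= N / 2 * ((1 - rho) * rho ^+ n.+1).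
    by rewrite !mulr_ge0 ?subr_ge0 ?exprn_ge0 ?(ltW r0) ?(ltW r1) // ltW.
  rewrite /u /exp_coeff /= exprNn -signr_odd.
  have := odd_double_half n.+1; case: (odd n.+1) => /= E; last first.
    by rewrite expr0 mul1r subrr mulr0.
  have := none (n.+1)./2 => /negP; rewrite -ltNge; rewrite add1n in E; rewrite E => Hn.
  rewrite expr1 mulN1r mulNr opprK.
  move: (mu ^+ n.+1 / _) Hn => w Hn; rewrite -/N in Hn.
  rewrite (_ : _ * (w + w) = 2 * (p.[n.+1%:R] ^+ 2 * w)); last by ring.
  have := ler_wpM2l (ler0n R 2) (ltW Hn) => /le_trans; apply.
  by rewrite le_eqVlt; apply/orP; left; apply/eqP; field.
have : P - A <= N / 2 * rho.
  apply: (cvgr_to_le cu); near=> n.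
  have n0 : (0 < n)%N by near: n; exists 1%N.
  rewrite -(prednK n0); apply: le_trans (ub _) _.
  have Nk : 0 <= N / 2 by rewrite divr_ge0 // ltW // /N.
  by rewrite ler_wpM2l // lerBlDr lerDl exprn_ge0 // ltW.
have : 0 < N by apply: N0.
move: Pk AP; rewrite -/N; nra.
Unshelve. all: by end_near. Qed.

(** * Bounds on a single shape *)

Definition node_poly (R : realType) (y : nat -> R) (k : nat) : {poly R} :=
  \prod_(i < k) ('X - (y i)%:P).

Lemma node_poly_monic (R : realType) (y : nat -> R) k : node_poly y k \is monic.
Proof. by apply: rpred_prod => i _; apply: monicXsubC. Qed.

Lemma size_node_poly (R : realType) (y : nat -> R) k : size (node_poly y k) = k.+1.
Proof. by rewrite /node_poly size_prod_XsubC /index_enum -enumT size_enum_ord. Qed.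

Lemma horner_node_poly (R : realType) (y : nat -> R) k x :
  (node_poly y k).[x] = \prod_(i < k) (x - y i).
Proof.
by rewrite /node_poly horner_prod; apply: eq_bigr => i _; rewrite hornerXsubC.
Qed.

(** Each point is chosen by [odd_mass] for the monic polynomial vanishing at the
    previous points; the Vandermonde product is then the product of the values
    of these polynomials. *)
Lemma leja_points (R : realType) (mu kappa rho : R) l n :
  0 < mu -> 0 < kappa < 1 -> l%:R <= kappa ^+ 2 * mu ->
  l%:R * expR (- ((1 - kappa) ^+ 2 * mu) / 2) <= 1 / 2 ->
  0 < rho < 1 -> (n <= l)%N ->
  exists h : nat -> nat, forall k, (k < n)%N ->
    charlier_norm mu k / 4 * ((1 - rho) * rho ^+ (h k).*2.+1) <=
    (\prod_(i < k) ((h k).*2.+1%:R - (h i).*2.+1%:R)) ^+ 2 *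
      (mu ^+ (h k).*2.+1 / ((h k).*2.+1)`!%:R).
Proof.
move=> mu0 k01 lk ld r01; elim: n => [|n IH] nl; first by exists (fun=> 0%N).
have [h Hh] := IH (ltnW nl).
pose y i : R := (h i).*2.+1%:R.
have [x Hx] := odd_mass mu0 k01 lk ld nl (node_poly_monic y n) (size_node_poly y n) r01.
exists (fun i => if i == n then x else h i) => k; rewrite ltnS leq_eqVlt.
case: eqP => [->|_] /= kn.
  move: Hx; rewrite horner_node_poly => /le_trans; apply.
  rewrite le_eqVlt; apply/orP; left; apply/eqP; congr (_ ^+ 2 * _).
  by apply: eq_bigr => i _; rewrite ltn_eqF.
apply: le_trans (Hh k kn) _.
rewrite le_eqVlt; apply/orP; left; apply/eqP; congr (_ ^+ 2 * _).
by apply: eq_bigr => i _; rewrite ltn_eqF // (ltn_trans (ltn_ord i)).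
Qed.

Definition tri (l : nat) : nat := \sum_(q < l) q.

Lemma ffact_poly (R : realType) (a : R) q n :
  (node_poly (fun i => i.*2%:R + a) q).[n.*2%:R + a] = 2 ^+ q * (n ^_ q)%:R.
Proof.
rewrite horner_node_poly; elim: q => [|q IH].
  by rewrite big_ord0 ffactn0 mulr1.
rewrite big_ord_recr IH ffactnSr natrM exprS /=.
case: (leqP q n) => qn; last by rewrite ffact_small // !(mulr0, mul0r).
by rewrite natrB // -!mul2n !natrM; ring.
Qed.

(** The points 2h + a serve both bounds: a = 0 for the upper and a = 1 for the
    lower one. *)
Lemma det_ffact (R : realType) (a : R) l (h : 'I_l -> nat) (P : nat -> {poly R}) :
  (forall q, P q \is monic) -> (forall q, size (P q) = q.+1) ->
  \det (\matrix_(j < l, q < l) (P q).[(h j).*2%:R + a]) =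
  2 ^+ tri l * \det (\matrix_(j < l, q < l) (h j ^_ q)%:R).
Proof.
move=> mP sP; rewrite (det_monic _ mP sP).
rewrite -(det_monic _ (node_poly_monic (fun i => i.*2%:R + a))
                      (size_node_poly (fun i => i.*2%:R + a))).
have -> : 2 ^+ tri l = \det (diag_mx (\row_(q < l) 2 ^+ q)) :> R.
  rewrite det_diag /tri; rewrite (big_morph _ (exprD 2) (expr0 2)).
  by apply: eq_bigr => q _; rewrite mxE.
rewrite mulrC -det_mulmx; congr (\det _); apply/matrixP => j q.
by rewrite mul_mx_diag !mxE ffact_poly mulrC.
Qed.

Lemma fact_even_le h : ((h.*2)`! <= 4 ^ h * h`! ^ 2)%N.
Proof.
elim: h => // h IH; rewrite doubleS !factS expnS.
rewrite expnMn; nia.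
Qed.

Lemma fact_odd_ge h : (4 ^ h * h`! ^ 2 <= (h.*2.+1)`!)%N.
Proof.
elim: h => // h IH; rewrite doubleS (factS h.*2.+2) (factS h.*2.+1) (factS h) expnS.
rewrite expnMn; nia.
Qed.

(** The common value of the two bounds, apart from the factor (4 / mu ^ 2) ^ m:
    the product of the Charlier norms of degrees less than l over mu ^ (2 tri l),
    where this power collects what the doubling of the points and the part
    [tri] l of the sum of the h_j contribute.  Up to
    elementary factors it is the partition function of the Gaussian unitary
    ensemble. *)
Definition Phi (R : realType) (mu : R) (l : nat) : R :=
  (\prod_(k < l) k`!%:R) * expR (mu * l%:R) / mu ^+ tri l.

Lemma Phi_norm (R : realType) (mu : R) l : 0 < mu ->
  \prod_(k < l) charlier_norm mu k = Phi mu l * mu ^+ tri l ^+ 2.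
Proof.
move=> mu0; rewrite /charlier_norm !big_split /= -(big_morph _ (exprD mu) (expr0 mu)).
rewrite -/(tri l) big_const_ord iter_mulr_1 -expRM_natr /Phi.
by field; rewrite expf_neq0 // gt_eqF.
Qed.

(** The Leibniz expansion instead of Hadamard's inequality: the extra l! is
    exp (o(l ^ 2)). *)
Lemma det_sqr_le (R : realType) l (A : 'M[R]_l) (W N : R) : 0 < W -> 0 <= N ->
  (forall s : 'S_l, (\prod_j A j (s j)) ^+ 2 * W <= N) ->
  \det A ^+ 2 * W <= l`!%:R ^+ 2 * N.
Proof.
move=> W0 N0 H.
have M0 : 0 <= Num.sqrt (N / W) by apply: sqrtr_ge0.
have VM : `|\det A| <= l`!%:R * Num.sqrt (N / W).
  apply: le_trans (ler_norm_sum _ _ _) _.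
  apply: (@le_trans _ _ (\sum_(s : 'S_l) Num.sqrt (N / W))).
    apply: ler_sum => s _; rewrite normrM normrX normrN1 expr1n mul1r.
    rewrite -sqrtr_sqr ler_wsqrtr // ler_pdivlMr //; exact: H.
  by rewrite sumr_const -[leLHS]mulr_natl ler_wpM2r // ler_nat -card_Sn max_card.
rewrite -ler_pdivlMr // -mulrA -(sqr_sqrtr (_ : 0 <= N / W)) ?divr_ge0 // ?(ltW W0) //.
by rewrite -exprMn -[leLHS]real_normK ?num_real // lerXn2r // nnegrE ?mulr_ge0.
Qed.

Lemma prod_natX (R : realType) (l : nat) (a : R) (h : 'I_l -> nat) :
  \prod_j a ^+ h j = a ^+ (\sum_j h j)%N.
Proof. by rewrite -(big_morph _ (exprD a) (expr0 a)). Qed.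

(** The Vandermonde product at the points 2h_j is the determinant of the Charlier
    polynomials there, bounded termwise by [charlier_sqr_le]; the inequality
    (2h)! <= 4 ^ h h! ^ 2 changes the Poisson weight at 2h into 1 / h! ^ 2. *)
Lemma schur_upper (R : realType) (mu : R) l m (h : 'I_l -> nat) :
  0 < mu -> (\sum_j h j = m + tri l)%N ->
  schur R h ^+ 2 <= l`!%:R ^+ 2 * (4 / mu ^+ 2) ^+ m * Phi mu l.
Proof.
move=> mu0 Hs.
pose F : R := \prod_j (h j)`!%:R.
pose W : R := \prod_j (mu ^+ (h j).*2 / ((h j).*2)`!%:R).
pose N : R := \prod_(k < l) charlier_norm mu k.
have W0 : 0 < W by apply: prodr_gt0 => j _; rewrite divr_gt0 ?exprn_gt0 // ltr0n fact_gt0.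
have N0 : 0 <= N by apply: prodr_ge0 => k _; rewrite ltW // charlier_norm_gt0.
have E := schur_ffact R h.
have V := det_ffact 0 h (charlier_monic mu) (size_charlier mu).
have key : schur R h ^+ 2 * (4 ^+ tri l * (F ^+ 2 * W)) <= l`!%:R ^+ 2 * N.
  rewrite (_ : _ * _ = (2 ^+ tri l * \det (\matrix_(j < l, q < l) (h j ^_ q)%:R)) ^+ 2 * W).
    rewrite -V; apply: det_sqr_le => // s.
    have -> : N = \prod_j charlier_norm mu (s j) by rewrite /N (reindex_inj (@perm_inj _ s)).
    rewrite -prodrXl -big_split /=.
    apply: ler_prod => j _; rewrite mulr_ge0 ?sqr_ge0 ?divr_ge0 ?exprn_ge0 ?(ltW mu0) //=.
    by rewrite mxE addr0; apply: charlier_sqr_le.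
  rewrite [in RHS]exprMn -E (_ : (4 : R) = 2 * 2); last by ring.
  by rewrite (exprMn (tri l)) -/F; ring.
have low : (mu ^+ 2 / 4) ^+ (m + tri l) <= F ^+ 2 * W.
  rewrite -Hs -prod_natX /F /W -prodrXl -big_split /=; apply: ler_prod => j _.
  rewrite exprn_ge0 ?divr_ge0 ?sqr_ge0 //=.
  have f0 : 0 < ((h j).*2)`!%:R :> R by rewrite ltr0n fact_gt0.
  rewrite mulrA ler_pdivlMr // expr_div_n -exprM mul2n mulrAC ler_pdivrMr ?exprn_gt0 //.
  rewrite -mulrA [leRHS]mulrC -mulrA ler_wpM2l ?exprn_ge0 ?(ltW mu0) //.
  by have := fact_even_le (h j); rewrite -(ler_nat R) natrM !natrX.
have T0 : 0 < mu ^+ tri l by rewrite exprn_gt0.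
have P0 : 0 < (mu ^+ 2 / 4) ^+ m by rewrite exprn_gt0 // divr_gt0 ?exprn_gt0.
rewrite -(ler_pM2r (_ : 0 < (mu ^+ 2 / 4) ^+ m * mu ^+ tri l ^+ 2)); last first.
  by rewrite mulr_gt0 // exprn_gt0.
rewrite [leRHS](_ : _ = l`!%:R ^+ 2 * N); last first.
  have EV : 4 / mu ^+ 2 = (mu ^+ 2 / 4)^-1 by rewrite invf_div.
  rewrite /N Phi_norm // EV exprVn.
  by field; rewrite gt_eqF.
apply: le_trans key; rewrite ler_wpM2l ?sqr_ge0 //.
have := ler_wpM2l (_ : 0 <= 4 ^+ tri l) low => /(_ (exprn_ge0 _ (ler0n _ _))).
apply: le_trans; rewrite exprD !expr_div_n -!exprM !(mulnC 2) !exprM le_eqVlt.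
by apply/orP; left; apply/eqP; field; rewrite !expf_neq0.
Qed.

(** For the Leja points y_j = 2h_j + 1 the determinant of the polynomials which
    vanish at the previous points is triangular; the inequality
    4 ^ h h! ^ 2 <= (2h + 1)! changes the weight at 2h + 1 into 1 / h! ^ 2. *)
Lemma schur_lower (R : realType) (mu kappa rho : R) l :
  0 < mu -> 0 < kappa < 1 -> l%:R <= kappa ^+ 2 * mu ->
  l%:R * expR (- ((1 - kappa) ^+ 2 * mu) / 2) <= 1 / 2 ->
  0 < rho < 1 ->
  exists m, exists2 h : 'I_l -> nat,
    injective h /\ (\sum_j h j = m + tri l)%N &
    (4 / mu ^+ 2) ^+ m * Phi mu l * ((1 - rho) / (4 * mu)) ^+ l *
      rho ^+ ((m + tri l).*2 + l) <= schur R h ^+ 2.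
Proof.
move=> mu0 k01 lk ld r01; have /andP[r0 r1] := r01.
have [f Hf] := leja_points mu0 k01 lk ld r01 (leqnn l).
pose h (j : 'I_l) := f j.
have L0 k : 0 < charlier_norm mu k / 4 * ((1 - rho) * rho ^+ (f k).*2.+1).
  by rewrite mulr_gt0 ?divr_gt0 ?charlier_norm_gt0 // mulr_gt0 ?subr_gt0 ?exprn_gt0.
have fne (i j : 'I_l) : (i < j)%N -> f i != f j.
  move=> ij; apply/negP => /eqP E; have := Hf j (ltn_ord j); rewrite leNgt.
  by rewrite (bigD1 (Ordinal ij)) //= E subrr mul0r expr0n mul0r L0.
have hinj : injective h.
  move=> i j E; apply: val_inj; case: (ltngtP i j) => // /fne.
    by rewrite -/(h i) E eqxx.
  by rewrite -/(h i) -/(h j) E eqxx.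
have [m Hs] : exists m, (\sum_j h j = m + tri l)%N.
  by exists (\sum_j h j - tri l)%N; rewrite subnK // sum_inj_ge.
exists m, h; first by split.
pose y i : R := (f i).*2%:R + 1.
pose F : R := \prod_j (h j)`!%:R.
pose W : R := \prod_j (mu ^+ (h j).*2.+1 / ((h j).*2.+1)`!%:R).
pose N : R := \prod_(k < l) charlier_norm mu k.
have E := schur_ffact R h.
have V := det_ffact 1 h (node_poly_monic y) (size_node_poly y).
have key : N * ((1 - rho) / 4) ^+ l * rho ^+ ((m + tri l).*2 + l) <=
    schur R h ^+ 2 * (4 ^+ tri l * (F ^+ 2 * W)).
  rewrite [leRHS](_ : _ = (2 ^+ tri l * \det (\matrix_(j < l, q < l) (h j ^_ q)%:R)) ^+ 2 * W);
      last first.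
    rewrite [in RHS]exprMn -E (_ : (4 : R) = 2 * 2); last by ring.
    by rewrite (exprMn (tri l)) -/F; ring.
  rewrite -V det_trig; last first.
    apply/is_trig_mxP => j q jq; rewrite mxE horner_node_poly.
    by rewrite (bigD1 (Ordinal jq)) //= subrr mul0r.
  rewrite -prodrXl /W -big_split /=.
  have -> : ((m + tri l).*2 + l = \sum_(j < l) (h j).*2.+1)%N.
    rewrite -Hs [RHS](eq_bigr (fun j => (h j + h j + 1)%N)) => [|j _]; last by rewrite addnn addn1.
    by rewrite !big_split /= sum1_card card_ord addnn.
  have -> : ((1 - rho) / 4) ^+ l = \prod_(j < l) ((1 - rho) / 4).
    by rewrite prodr_const card_ord.
  rewrite -prod_natX /N -!big_split /=.
  apply: ler_prod => j _; apply/andP; split.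
    by have := L0 j; rewrite -/(h j) => /ltW; rewrite !mulrA [_ / 4 * _]mulrAC.
  rewrite mxE horner_node_poly.
  apply: le_trans (le_trans _ (Hf j (ltn_ord j))) _.
    by rewrite le_eqVlt; apply/orP; left; apply/eqP; field.
  rewrite le_eqVlt; apply/orP; left; apply/eqP; congr (_ ^+ 2 * _).
  by apply: eq_bigr => i _; rewrite /y /h -!natr1.
have up : F ^+ 2 * W <= mu ^+ l * (mu ^+ 2 / 4) ^+ (m + tri l).
  have -> : mu ^+ l = \prod_(j < l) mu by rewrite prodr_const card_ord.
  rewrite -Hs -prod_natX /F /W -prodrXl -!big_split /=.
  apply: ler_prod => j _.
  have f0 : 0 < ((h j).*2.+1)`!%:R :> R by rewrite ltr0n fact_gt0.
  rewrite mulr_ge0 ?sqr_ge0 ?divr_ge0 ?exprn_ge0 ?(ltW mu0) //=.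
  have q1 : 4 ^+ h j * (h j)`!%:R ^+ 2 / ((h j).*2.+1)`!%:R <= 1 :> R.
    rewrite ler_pdivrMr // mul1r.
    by have := fact_odd_ge (h j); rewrite -(ler_nat R) natrM !natrX.
  have q0 : 0 <= mu * (mu ^+ 2 / 4) ^+ h j.
    by rewrite mulr_ge0 ?exprn_ge0 ?divr_ge0 ?exprn_ge0 ?(ltW mu0).
  rewrite [leLHS](_ : _ = mu * (mu ^+ 2 / 4) ^+ h j *
      (4 ^+ h j * (h j)`!%:R ^+ 2 / ((h j).*2.+1)`!%:R)); first exact: ler_piMr.
  rewrite expr_div_n -exprM mul2n [mu ^+ _.+1]exprS; field.
  by rewrite expf_neq0 // gt_eqF.
have T0 : 0 < mu ^+ tri l by rewrite exprn_gt0.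
have P0 : 0 < (mu ^+ 2 / 4) ^+ m by rewrite exprn_gt0 // divr_gt0 ?exprn_gt0.
rewrite -(ler_pM2r (_ : 0 < (mu ^+ 2 / 4) ^+ m * mu ^+ tri l ^+ 2 * mu ^+ l)); last first.
  by rewrite !mulr_gt0 // exprn_gt0.
rewrite [leLHS](_ : _ = N * ((1 - rho) / 4) ^+ l * rho ^+ ((m + tri l).*2 + l)); last first.
  have EV : 4 / mu ^+ 2 = (mu ^+ 2 / 4)^-1 by rewrite invf_div.
  rewrite /N Phi_norm // EV exprVn.
  rewrite !(exprMn l) !exprVn (exprMn l).
  have [q1 q2 q3] : [/\ (4 : R) ^+ l != 0, mu ^+ l != 0 & (mu ^+ 2 / 4) ^+ m != 0].
    by rewrite gt_eqF ?(gt_eqF P0) ?[mu ^+ l == 0]gt_eqF ?exprn_gt0.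
  by field; rewrite q1 q2 q3.
apply: le_trans key _; rewrite ler_wpM2l ?sqr_ge0 //.
have := ler_wpM2l (_ : 0 <= 4 ^+ tri l) up => /(_ (exprn_ge0 _ (ler0n _ _))) /le_trans; apply.
rewrite exprD !expr_div_n -!exprM !(mulnC 2) !exprM le_eqVlt.
by apply/orP; left; apply/eqP; field; rewrite !expf_neq0.
Qed.

(** * Logarithmic asymptotics of Phi *)

Lemma ln_le_subr1 (R : realType) (x : R) : 0 < x -> ln x <= x - 1.
Proof. by move=> x0; have := expR_ge1Dx (ln x); rewrite lnK // ; lra. Qed.

Lemma ln_step_le (R : realType) k : (0 < k)%N ->
  ln k.+1%:R - ln k%:R <= k%:R^-1 :> R.
Proof.
move=> k0; have kR : 0 < k%:R :> R by rewrite ltr0n.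
rewrite -ln_div ?posrE ?ltr0n //; apply: le_trans (ln_le_subr1 _) _.
  by rewrite divr_gt0 ?ltr0n.
rewrite -natr1 mulrDl mul1r divff ?gt_eqF //; lra.
Qed.

Lemma ln_step_ge (R : realType) k : (0 < k)%N ->
  k.+1%:R^-1 <= ln k.+1%:R - ln k%:R :> R.
Proof.
move=> k0; have kR : 0 < k%:R :> R by rewrite ltr0n.
have kR1 : 0 < k.+1%:R :> R by rewrite ltr0n.
have := @ln_le_subr1 R (k%:R / k.+1%:R) (divr_gt0 kR kR1).
rewrite ln_div ?posrE //.
have -> : k%:R / k.+1%:R - 1 = - (k.+1%:R^-1) :> R.
  rewrite -natr1; field; rewrite natr1 gt_eqF //.
by move=> H; rewrite -[leRHS]opprB lerNr.
Qed.

(** Stirling's formula up to a factor of order k: the increments of k ln k - k are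
    compared with ln (k + 1) by means of 1 / (k + 1) <= ln (1 + 1 / k) <= 1 / k. *)
Lemma ln_fact_bounds (R : realType) k : (0 < k)%N ->
  k%:R * ln k%:R - k%:R <= ln k`!%:R :> R /\
  ln k`!%:R <= k%:R * ln k%:R - k%:R + 1 + ln k%:R :> R.
Proof.
elim: k => // k IH _; case: (posnP k) => [->|k0].
  by rewrite (_ : 1`! = 1%N) // ln1; split; lra.
have [l u] := IH k0; have kR : 0 < k%:R :> R by rewrite ltr0n.
rewrite factS natrM lnM ?posrE ?ltr0n ?fact_gt0 //.
have H1 := ln_step_le R k0; have H2 := ln_step_ge R k0.
have G1 : k%:R * (ln k.+1%:R - ln k%:R) <= 1 :> R.
  by rewrite mulrC -ler_pdivlMr // div1r.
have G2 : k.+1%:R * (ln k.+1%:R - ln k%:R) >= 1 :> R.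
  by rewrite mulrC -ler_pdivrMr ?ltr0n // div1r.
move: (ln k.+1%:R) G1 G2 H1 H2 => b; rewrite -natr1 => G1 G2 H1 H2.
move: l u; move: (ln k%:R) (ln k`!%:R) G1 G2 H1 H2 => a F G1 G2 H1 H2 l u.
split; lra.
Qed.

(** A primitive of x ln x - x, which approximates ln x!. *)
Definition superfact_main (R : realType) (l : nat) : R :=
  l%:R ^+ 2 / 2 * ln l%:R - 3 / 4 * l%:R ^+ 2.

Lemma superfact_bounds (R : realType) l : (0 < l)%N ->
  `|\sum_(k < l) ln k`!%:R - superfact_main R l| <= l%:R * (3 + 2 * ln l%:R).
Proof.
elim: l => // l IH _; case: (posnP l) => [->|l0].
  rewrite big_ord1 fact0 /superfact_main ln1 expr1n !mulr0 sub0r mulr1 sub0r opprK.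
  by rewrite ger0_norm; lra.
have := IH l0; rewrite big_ord_recr /= !ler_norml => /andP[h1 h2].
have [f1 f2] := ln_fact_bounds R l0.
have lR : 1 <= l%:R :> R by rewrite ler1n.
have H1 := ln_step_le R l0; have H2 := ln_step_ge R l0.
have l1 : 0 <= ln l%:R :> R by apply: ln_ge0.
set a := ln l%:R in l1 H1 H2 f1 f2 h1 h2 *.
set x := l%:R in lR H1 H2 f1 f2 h1 h2 *.
set d := ln l.+1%:R - a in H1 H2.
have E : ln l.+1%:R = a + d by rewrite /d; ring.
have x0 : 0 < x by lra.
have G1 : x * d <= 1 by rewrite mulrC -ler_pdivlMr // div1r.
have G2 : (x + 1) * d >= 1.
  by rewrite mulrC -ler_pdivrMr ?div1r /x ?natr1 // ltr0n.
have d0 : 0 <= d by apply: le_trans H2; rewrite invr_ge0.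
have G3 : x ^+ 2 * d <= x by rewrite expr2 -mulrA ler_piMr // ltW.
have G4 : x ^+ 2 * d >= x - 1.
  have : (x - 1) * ((x + 1) * d) >= x - 1 by rewrite ler_peMr // subr_ge0.
  by nra.
move: h1 h2; rewrite /superfact_main -/a -/x -[l.+1%:R]natr1 -/x natr1 E => h1 h2.
have xa : 0 <= x * a by rewrite mulr_ge0 // ltW.
apply/andP; split.
  apply: (@le_trans _ _ (- (x * (3 + 2 * a)) + (ln l`!%:R - (x * a - x)) + (- 3 - 2 * a))).
    nra.
  nra.
nra.
Qed.

Lemma inv_sqrt_cvg0 (R : realType) :
  (fun n => (Num.sqrt (n%:R : R))^-1) @ \oo --> (0 : R).
Proof.
have H : (fun n => Num.sqrt (n%:R^-1 : R)) @ \oo --> (0 : R).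
  have h : (fun n => n%:R^-1 : R) @ \oo --> (0 : R).
    by rewrite -cvg_shiftS; apply: cvg_harmonic.
  by have := cvg_comp _ _ h (@sqrt_continuous R 0); rewrite sqrtr0.
apply: cvg_trans H; apply: near_eq_cvg; near=> n.
by rewrite sqrtrV.
Unshelve. all: by end_near. Qed.

Lemma ln_sqrt_cvg0 (R : realType) :
  (fun n => ln (Num.sqrt (n%:R : R)) / Num.sqrt n%:R) @ \oo --> (0 : R).
Proof.
have H : (fun n => 2 * Num.sqrt ((Num.sqrt (n%:R : R))^-1)) @ \oo --> (0 : R).
  rewrite -[X in _ --> X](mulr0 2); apply: cvgM; first exact: cvg_cst.
  by have := cvg_comp _ _ (@inv_sqrt_cvg0 R) (@sqrt_continuous R 0); rewrite sqrtr0.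
apply: (@squeeze_cvgr _ _ _ _ (fun=> 0)); [|exact: cvg_cst|exact: H].
near=> n.
have n1 : (0 < n)%N by near: n; exists 1%N.
have s1 : 1 <= Num.sqrt (n%:R : R) by rewrite -[leLHS]sqrtr1 ler_wsqrtr // ler1n.
set s := Num.sqrt n%:R in s1 *.
have s0 : 0 < s by lra.
rewrite divr_ge0 ?ln_ge0 ?(ltW s0) //= ler_pdivrMr // sqrtrV ?(ltW s0) //.
have q0 : 0 < Num.sqrt s by rewrite sqrtr_gt0.
have Es : s = Num.sqrt s ^+ 2 by rewrite sqr_sqrtr // ltW.
rewrite [X in ln X]Es lnXn // [leRHS](_ : _ = 2 * Num.sqrt s); last first.
  by rewrite [X in _ * X]Es; field; rewrite gt_eqF.
by rewrite -[leLHS]mulr_natl ler_wpM2l // ltW // ln_sublinear.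
Unshelve. all: by end_near. Qed.

(** Then Lmax < alpha sqrt n means Lmax <= l n. *)
Definition crit_index (R : realType) (alpha : R) (l : nat -> nat) : Prop :=
  forall n, (0 < n)%N ->
  (l n)%:R < alpha * Num.sqrt (n%:R : R) <= (l n).+1%:R.

Lemma ratio_cvg (R : realType) (alpha : R) l : crit_index alpha l ->
  (fun n => (l n)%:R / Num.sqrt (n%:R : R)) @ \oo --> alpha.
Proof.
move=> Hl.
apply: (@squeeze_cvgr _ _ _ _ (fun n => alpha - (Num.sqrt (n%:R : R))^-1) (fun=> alpha)); last exact: cvg_cst.
  near=> n; have n1 : (0 < n)%N by near: n; exists 1%N.
  have s0 : 0 < Num.sqrt (n%:R : R) by rewrite sqrtr_gt0 ltr0n.
  have /andP[h1 h2] := Hl n n1.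
  rewrite ler_pdivlMr // ler_pdivrMr // (ltW h1) andbT mulrBl mulVf ?gt_eqF //.
  by rewrite lerBlDr natr1.
rewrite -[X in _ --> X]subr0; apply: cvgB; first exact: cvg_cst.
exact: inv_sqrt_cvg0.
Unshelve. all: by end_near. Qed.

Lemma tri_half (R : realType) l : (tri l)%:R = (l%:R ^+ 2 - l%:R) / 2 :> R.
Proof.
elim: l => [|l IH]; first by rewrite /tri big_ord0 expr2 mul0r subrr mul0r.
by rewrite /tri big_ord_recr /= natrD -/(tri l) IH -natr1; field.
Qed.

Lemma ln_prod (R : realType) n (F : nat -> R) : (forall k, 0 < F k) ->
  ln (\prod_(k < n) F k) = \sum_(k < n) ln (F k).
Proof.
move=> F0; elim: n => [|n IH]; first by rewrite !big_ord0 ln1.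
by rewrite !big_ord_recr /= lnM ?posrE ?IH // prodr_gt0.
Qed.

Lemma fact_gt0R (R : realType) k : 0 < k`!%:R :> R.
Proof. by rewrite ltr0n fact_gt0. Qed.

Lemma Phi_gt0 (R : realType) (mu : R) l : 0 < mu -> 0 < Phi mu l.
Proof.
move=> mu0; rewrite /Phi divr_gt0 ?exprn_gt0 // mulr_gt0 ?expR_gt0 //.
by apply: prodr_gt0 => k _; apply: fact_gt0R.
Qed.

Lemma ln_Phi (R : realType) (mu : R) l : 0 < mu ->
  ln (Phi mu l) = \sum_(k < l) ln k`!%:R + mu * l%:R - (l%:R ^+ 2 - l%:R) / 2 * ln mu.
Proof.
move=> mu0; have T0 : 0 < mu ^+ tri l by rewrite exprn_gt0.
have P0 : 0 < \prod_(k < l) (k`!%:R : R) by apply: prodr_gt0 => k _; apply: fact_gt0R.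
rewrite /Phi ln_div ?posrE ?mulr_gt0 ?expR_gt0 // lnM ?posrE ?expR_gt0 // expRK.
by rewrite lnXn // -[ln mu *+ _]mulr_natl tri_half (@ln_prod _ l (fun k => k`!%:R)) // => k; apply: fact_gt0R.
Qed.

Definition phi (R : realType) (alpha lam : R) : R :=
  alpha ^+ 2 / 2 * ln (alpha / lam) - 3 / 4 * alpha ^+ 2 + lam * alpha.

(** With x = l / sqrt n, the logarithm of [Phi] over n is [phi] x lam up to terms
    of order ln n / sqrt n: the contributions of ln n to the superfactorial and to
    the power of mu cancel, as both exponents are l ^ 2 / 2 at leading order. *)
Lemma Phi_asympt (R : realType) (alpha lam : R) l :
  0 < alpha -> 0 < lam -> crit_index alpha l ->
  (fun n => n%:R^-1 * ln (Phi (lam * Num.sqrt (n%:R : R)) (l n))) @ \oo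
    --> phi alpha lam.
Proof.
move=> a0 lam0 Hl.
pose s n := Num.sqrt (n%:R : R); pose x n := (l n)%:R / s n.
have xc : x @ \oo --> alpha := ratio_cvg Hl.
have ic : (fun n => (s n)^-1) @ \oo --> (0 : R) := @inv_sqrt_cvg0 R.
have lc : (fun n => ln (s n) / s n) @ \oo --> (0 : R) := @ln_sqrt_cvg0 R.
pose M n := x n ^+ 2 / 2 * ln (x n / lam) - 3 / 4 * x n ^+ 2 + lam * x n
  + x n / 2 * (ln lam * (s n)^-1 + ln (s n) / s n).
pose E n := x n * ((3 + 2 * ln alpha) * (s n)^-1 + 2 * (ln (s n) / s n)).
have Ec : E @ \oo --> (0 : R).
  rewrite -[X in _ --> X](mulr0 alpha); apply: cvgM => //.
  rewrite -[X in _ --> X](addr0 0); apply: cvgD.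
    by rewrite -[X in _ --> X](mulr0 (3 + 2 * ln alpha)); apply: cvgM => //; apply: cvg_cst.
  by rewrite -[X in _ --> X](mulr0 2); apply: cvgM => //; apply: cvg_cst.
have x2c : (fun n => x n ^+ 2) @ \oo --> alpha ^+ 2 by rewrite expr2; under eq_fun do rewrite expr2; apply: cvgM.
have Mc : M @ \oo --> phi alpha lam.
  rewrite -[X in _ --> X]addr0; apply: cvgD; last first.
    rewrite -[X in _ --> X](mulr0 (alpha / 2)); apply: cvgM.
      by apply: cvgM => //; apply: cvg_cst.
    rewrite -[X in _ --> X](addr0 0); apply: cvgD => //.
    by rewrite -[X in _ --> X](mulr0 (ln lam)); apply: cvgM => //; apply: cvg_cst.
  apply: cvgD; last by apply: cvgM => //; apply: cvg_cst.
  apply: cvgB; last by apply: cvgM => //; apply: cvg_cst.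
  apply: cvgM; first by apply: cvgM => //; apply: cvg_cst.
  have xl : (fun n => x n / lam) @ \oo --> alpha / lam.
    by apply: cvgM => //; apply: cvg_cst.
  have al : 0 < alpha / lam by rewrite divr_gt0.
  exact: (cvg_comp _ _ xl (continuous_ln al)).
apply: (@squeeze_cvgr _ _ _ _ (fun n => M n - E n) (fun n => M n + E n)); first last.
- by rewrite -[X in _ --> X]addr0; apply: cvgD.
- by rewrite -[X in _ --> X]subr0; apply: cvgB.
near=> n.
have n1 : (0 < n)%N by near: n; exists 1%N.
have x0 : 0 < x n by near: n; apply: (cvgr_gt alpha).
have s0 : 0 < s n by rewrite /s sqrtr_gt0 ltr0n.
have nE : n%:R = s n ^+ 2 by rewrite sqr_sqrtr.
have lE : (l n)%:R = x n * s n by rewrite /x divfK // gt_eqF.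
have l0 : (0 < l n)%N by rewrite -(ltr0n R) lE mulr_gt0.
have /andP[h1 _] := Hl n n1.
have xa : x n < alpha by rewrite ltr_pdivrMr.
have B := @superfact_bounds R (l n) l0.
rewrite ln_Phi ?mulr_gt0 //.
have lnl : ln (l n)%:R = ln (x n) + ln (s n) by rewrite lE lnM.
have lnx : ln (x n) <= ln alpha by rewrite ler_ln // ?posrE // ltW.
have lnxl : ln (x n / lam) = ln (x n) - ln lam by rewrite ln_div.
have lnls : ln (lam * s n) = ln lam + ln (s n) by rewrite lnM.
have main : n%:R^-1 * (\sum_(k < l n) ln k`!%:R + lam * s n * (l n)%:R -
    ((l n)%:R ^+ 2 - (l n)%:R) / 2 * ln (lam * s n)) - M n =
   (s n ^+ 2)^-1 * (\sum_(k < l n) ln k`!%:R - superfact_main R (l n)).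
  rewrite /M /superfact_main nE lnl lE lnxl lnls; field; rewrite gt_eqF //.
have Eb : `|(s n ^+ 2)^-1 * (\sum_(k < l n) ln k`!%:R - superfact_main R (l n))| <= E n.
  rewrite normrM ger0_norm ?invr_ge0 ?exprn_ge0 ?(ltW s0) //.
  apply: le_trans (ler_wpM2l _ B) _; first by rewrite invr_ge0 exprn_ge0 // ltW.
  rewrite [leLHS](_ : _ = x n * ((3 + 2 * ln (x n)) * (s n)^-1 + 2 * (ln (s n) / s n))); last first.
    by rewrite lnl lE; field; rewrite gt_eqF.
  rewrite /E ler_wpM2l ?(ltW x0) // lerD2r ler_wpM2r ?invr_ge0 ?(ltW s0) //; lra.
move: Eb; rewrite -main ler_norml -/(s n) => /andP[e1 e2].
by apply/andP; split; lra.
Unshelve. all: by end_near. Qed.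

(** * Exponential rate of the probabilities *)

Definition prob_le (R : realType) (n l : nat) : R :=
  Defs.uniform_prob R [set s : 'S_n | (Lmax s <= l)%N]%SET.

Lemma prob_leE (R : realType) n l :
  prob_le R n l = #|[set s : 'S_n | (Lmax s <= l)%N]%SET|%:R / n`!%:R.
Proof. by rewrite /prob_le /Defs.uniform_prob card_Sn. Qed.

Lemma prob_le_upper (R : realType) (mu : R) n l : 0 < mu ->
  prob_le R n l <=
  n`!%:R * n.+2%:R ^+ l * (l`!%:R ^+ 2 * (4 / mu ^+ 2) ^+ n * Phi mu l).
Proof.
move=> mu0; set M := _ * Phi mu l.
have M0 : 0 <= M.
  rewrite mulr_ge0 ?(ltW (Phi_gt0 _ mu0)) // mulr_ge0 ?sqr_ge0 //.
  by rewrite exprn_ge0 // divr_ge0 // sqr_ge0.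
have H (h : 'I_l -> nat) : (\sum_j h j = n + \sum_(q < l) q)%N -> schur R h <= Num.sqrt M.
  move=> Hs; apply: le_trans (ler_norm _) _; rewrite -sqrtr_sqr ler_wsqrtr //.
  exact: schur_upper.
have := card_Lmax_upper (sqrtr_ge0 M) H; rewrite exprMn sqr_sqrtr // => Hc.
rewrite prob_leE ler_pdivrMr ?fact_gt0R //; apply: le_trans Hc _.
by rewrite le_eqVlt; apply/orP; left; apply/eqP; ring.
Qed.

Lemma prob_le_antitone (R : realType) n m l : (n <= m)%N ->
  prob_le R m l <= prob_le R n l.
Proof.
move=> nm; rewrite -(subnK nm); elim: (m - n)%N => // d IH.
apply: le_trans IH; rewrite addSn !prob_leE factS natrM.
have F0 : (d + n)`!%:R != 0 :> R by rewrite gt_eqF // fact_gt0R.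
rewrite ler_pdivrMr ?mulr_gt0 ?ltr0n ?fact_gt0 // mulrCA divfK //.
by rewrite -natrM ler_nat card_Lmax_succ.
Qed.

Lemma prob_le_lower (R : realType) m l (h : 'I_l -> nat) :
  injective h -> (\sum_j h j = m + tri l)%N ->
  m`!%:R * schur R h ^+ 2 <= prob_le R m l.
Proof.
move=> hi Hs; have := card_Lmax_lower R hi Hs.
rewrite prob_leE ler_pdivlMr ?fact_gt0R // => H.
by rewrite [leLHS](_ : _ = (m`!%:R * schur R h) ^+ 2) //; ring.
Qed.

Lemma ln_ge_1subV (R : realType) (x : R) : 0 < x -> 1 - x^-1 <= ln x.
Proof.
move=> x0; have := @ln_le_subr1 R x^-1; rewrite invr_gt0 lnV ?posrE // => /(_ x0).
by rewrite lerNl opprB.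
Qed.

Lemma ln_fact_le (R : realType) k : ln k`!%:R <= k%:R * ln k%:R :> R.
Proof.
case: (posnP k) => [->|k0]; first by rewrite fact0 ln1 mul0r.
rewrite mulr_natl -lnXn ?ltr0n // ler_ln ?posrE ?fact_gt0R ?exprn_gt0 ?ltr0n //.
rewrite -natrX ler_nat -[X in (_ <= _ ^ X)%N]card_ord fact_prod.
rewrite big_add1 /= big_mkord -prod_nat_const; exact: leq_prod.
Qed.

(** One term of the exponential series at n is at most e ^ n.  As a bound on m! it
    is linear in m in the logarithm, which makes it convenient when only an upper
    bound on m is known. *)
Lemma ln_natr_fact_ge (R : realType) n m : (0 < n)%N ->
  m%:R * ln n%:R - n%:R <= ln m`!%:R :> R.
Proof.
move=> n0; have := @exp_coeff_le R n%:R m (ler0n _ _).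
rewrite ler_pdivrMr ?fact_gt0R // => H.
have nm0 : 0 < n%:R ^+ m :> R by rewrite exprn_gt0 // ltr0n.
have em0 : 0 < expR n%:R * m`!%:R :> R by rewrite mulr_gt0 ?expR_gt0 ?fact_gt0R.
have : ln (n%:R ^+ m) <= ln (expR n%:R * m`!%:R) :> R by rewrite ler_ln.
rewrite lnM ?posrE ?expR_gt0 ?fact_gt0R // expRK lnXn ?ltr0n //.
by rewrite -[ln n%:R *+ m]mulr_natl; lra.
Qed.

Lemma tri_double l : ((tri l).*2 + l = l ^ 2)%N.
Proof.
elim: l => [|l IH]; first by rewrite /tri big_ord0.
by rewrite /tri big_ord_recr /= -/(tri l); move: IH; rewrite -!mulnn; lia.
Qed.

Lemma lnX_natl (R : realType) (x : R) n : 0 < x -> ln (x ^+ n) = n%:R * ln x.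
Proof. by move=> x0; rewrite lnXn // mulr_natl. Qed.

Lemma ln4V (R : realType) (lam s : R) : 0 < lam -> 0 < s ->
  ln (4 / (lam * s) ^+ 2) = ln 4 - 2 * ln lam - 2 * ln s.
Proof.
move=> l0 s0; have ls : 0 < lam * s by rewrite mulr_gt0.
by rewrite ln_div ?posrE ?exprn_gt0 // lnX_natl // lnM //; ring.
Qed.

(** The shape given by [schur_lower] for rho = 1 - 1 / (2s), for which both
    (1 - rho) ^ l and rho ^ (2m + l ^ 2) are exp (o(s ^ 2)) when m is of order
    s ^ 2, together with [schur_upper] for all other parameters.  It is the
    comparison of the two that controls the number m of boxes. *)
Lemma near_optimal_shape (R : realType) (alpha lam s : R) l :
  0 < alpha < lam -> 1 <= s -> l%:R < alpha * s ->
  l%:R * expR (- ((1 - Num.sqrt (alpha / lam)) ^+ 2 * (lam * s)) / 2) <= 1 / 2 ->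
  exists m, exists2 g : R, 0 < g & [/\
    m%:R * (ln 4 - 2 * ln lam) - 2 * m%:R * ln s + ln (Phi (lam * s) l)
      - l%:R * (ln (8 * lam) + 2 * ln s) - (2 * m%:R + l%:R ^+ 2) / s <= ln g,
    forall lam1, 0 < lam1 ->
      ln g <= 2 * ln l`!%:R + m%:R * (ln 4 - 2 * ln lam1) - 2 * m%:R * ln s
              + ln (Phi (lam1 * s) l) &
    forall n, (n <= m)%N -> m`!%:R * g <= prob_le R n l].
Proof.
move=> /andP[a0 al] s1 ls le.
have s0 : 0 < s by lra.
have lam0 : 0 < lam by lra.
have mu0 : 0 < lam * s by rewrite mulr_gt0.
have q0 : 0 < alpha / lam by rewrite divr_gt0.
have q1 : alpha / lam < 1 by rewrite ltr_pdivrMr // mul1r.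
have k01 : 0 < Num.sqrt (alpha / lam) < 1.
  by rewrite sqrtr_gt0 q0 /= -[ltRHS]sqrtr1 ltr_sqrt.
have lk : l%:R <= Num.sqrt (alpha / lam) ^+ 2 * (lam * s).
  by rewrite sqr_sqrtr ?(ltW q0) // mulrA divfK ?gt_eqF // ltW.
pose rho := 1 - (2 * s)^-1.
have s2 : 0 < (2 * s)^-1 <= 1 / 2.
  rewrite invr_gt0 mulr_gt0 //= ler_pdivlMr // mulrC.
  by rewrite ler_pdivrMr ?mulr_gt0 //; lra.
have r01 : 0 < rho < 1 by rewrite /rho; case/andP: s2 => *; apply/andP; split; lra.
have [m [h [hi Hs] Hg]] := schur_lower mu0 k01 lk le r01.
have /andP[r0 r1] := r01.
set A := (X in X <= _) in Hg.
have B0 : 0 < (1 - rho) / (4 * (lam * s)) by rewrite divr_gt0 ?subr_gt0 ?mulr_gt0.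
have C0 : 0 < 4 / (lam * s) ^+ 2 by rewrite divr_gt0 ?exprn_gt0.
have P0 := @Phi_gt0 R (lam * s) l mu0.
have C0m : 0 < (4 / (lam * s) ^+ 2) ^+ m by rewrite exprn_gt0.
have B0l : 0 < ((1 - rho) / (4 * (lam * s))) ^+ l by rewrite exprn_gt0.
have r0N k : 0 < rho ^+ k by rewrite exprn_gt0.
have A0 : 0 < A by apply: mulr_gt0 => //; apply: mulr_gt0 => //; apply: mulr_gt0.
have g0 : 0 < schur R h ^+ 2 by apply: lt_le_trans A0 Hg.
exists m, (schur R h ^+ 2) => //; split.
- have HA : ln A <= ln (schur R h ^+ 2) by rewrite ler_ln.
  apply: le_trans HA.
  have CP : 0 < (4 / (lam * s) ^+ 2) ^+ m * Phi (lam * s) l by apply: mulr_gt0.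
  have CPB : 0 < (4 / (lam * s) ^+ 2) ^+ m * Phi (lam * s) l *
      ((1 - rho) / (4 * (lam * s))) ^+ l by apply: mulr_gt0.
  have -> : ln A = ln ((4 / (lam * s) ^+ 2) ^+ m) + ln (Phi (lam * s) l) +
     ln (((1 - rho) / (4 * (lam * s))) ^+ l) + ln (rho ^+ ((m + tri l).*2 + l)).
    by rewrite /A lnM ?posrE // lnM ?posrE // lnM ?posrE.
  rewrite (lnX_natl _ C0) (lnX_natl _ B0) (lnX_natl _ r0) ln4V //.
  rewrite (_ : (m + tri l).*2 + l = 2 * m + l ^ 2)%N; last first.
    by rewrite -(tri_double l) doubleD -mul2n addnA.
  rewrite natrD natrM natrX.
  have -> : (1 - rho) / (4 * (lam * s)) = (8 * lam * s ^+ 2)^-1.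
    by rewrite /rho; field; rewrite !gt_eqF.
  rewrite lnV ?posrE ?mulr_gt0 ?exprn_gt0 // [ln (8 * lam * _)]lnM ?posrE ?mulr_gt0 ?exprn_gt0 //.
  rewrite (lnX_natl 2 s0).
  have lr : - s^-1 <= ln rho.
    apply: le_trans (ln_ge_1subV r0).
    rewrite lerNl opprB lerBlDl -[rho^-1]div1r ler_pdivrMr // /rho.
    have -> : (1 + s^-1) * (1 - (2 * s)^-1) = 1 + s^-1 * (1 / 2 - (2 * s)^-1).
      by field; rewrite gt_eqF.
    rewrite lerDl mulr_ge0 ?invr_ge0 ?(ltW s0) // subr_ge0.
    by case/andP: s2.
  have N0 : 0 <= 2 * m%:R + l%:R ^+ 2 :> R by rewrite addr_ge0 ?sqr_ge0 // mulr_ge0.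
  have := ler_wpM2l N0 lr; rewrite mulrN; lra.
- move=> lam1 l10; have m10 : 0 < lam1 * s by rewrite mulr_gt0.
  have U := schur_upper m10 Hs.
  have C1 : 0 < 4 / (lam1 * s) ^+ 2 by rewrite divr_gt0 ?exprn_gt0.
  have P1 := @Phi_gt0 R (lam1 * s) l m10.
  have F := @fact_gt0R R l.
  have C1m : 0 < (4 / (lam1 * s) ^+ 2) ^+ m by rewrite exprn_gt0.
  have F2 : 0 < l`!%:R ^+ 2 :> R by rewrite exprn_gt0.
  have FC : 0 < l`!%:R ^+ 2 * (4 / (lam1 * s) ^+ 2) ^+ m by apply: mulr_gt0.
  have FCP : 0 < l`!%:R ^+ 2 * (4 / (lam1 * s) ^+ 2) ^+ m * Phi (lam1 * s) l.
    by apply: mulr_gt0.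
  have HA : ln (schur R h ^+ 2) <= ln (l`!%:R ^+ 2 * (4 / (lam1 * s) ^+ 2) ^+ m * Phi (lam1 * s) l).
    by rewrite ler_ln.
  apply: le_trans HA _.
  have -> : ln (l`!%:R ^+ 2 * (4 / (lam1 * s) ^+ 2) ^+ m * Phi (lam1 * s) l) =
     ln (l`!%:R ^+ 2) + ln ((4 / (lam1 * s) ^+ 2) ^+ m) + ln (Phi (lam1 * s) l).
    by rewrite lnM ?posrE // lnM ?posrE.
  by rewrite (lnX_natl _ F) (lnX_natl _ C1) ln4V //; lra.
- move=> n nm; apply: le_trans (prob_le_antitone R l nm).
  exact: prob_le_lower.
Qed.

Lemma cvg0_lin (R : realType) (x i L : nat -> R) (alpha a b : R) :
  x @ \oo --> alpha -> i @ \oo --> 0 -> L @ \oo --> 0 ->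
  (fun n => x n * (a * i n + b * L n)) @ \oo --> 0.
Proof.
move=> xc ic lc; rewrite -[X in _ --> X](mulr0 alpha); apply: cvgM => //.
rewrite -[X in _ --> X](addr0 0); apply: cvgD.
  by rewrite -[X in _ --> X](mulr0 a); apply: cvgM => //; apply: cvg_cst.
by rewrite -[X in _ --> X](mulr0 b); apply: cvgM => //; apply: cvg_cst.
Qed.

Lemma exponent_upper (R : realType) (alpha lam eps : R) l :
  0 < alpha -> 0 < lam -> 0 < eps -> crit_index alpha l ->
  \forall n \near \oo, 0 < prob_le R n (l n) ->
    n%:R^-1 * ln (prob_le R n (l n)) <=
    - 1 + (ln 4 - 2 * ln lam) + phi alpha lam + eps.
Proof.
move=> a0 lam0 e0 Hl.
pose s n := Num.sqrt (n%:R : R); pose x n := (l n)%:R / s n.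
pose i n := (s n)^-1; pose L n := ln (s n) / s n.
have xc : x @ \oo --> alpha := ratio_cvg Hl.
have ic : i @ \oo --> (0 : R) := @inv_sqrt_cvg0 R.
have lc : L @ \oo --> (0 : R) := @ln_sqrt_cvg0 R.
pose a n := n%:R^-1 * ln (Phi (lam * s n) (l n)).
have ac : a @ \oo --> phi alpha lam := Phi_asympt a0 lam0 Hl.
(* The three error terms come from n!, from the number of shapes and from l! ^ 2. *)
pose U n := a n + (i n * (1 * i n + 2 * L n) + x n * ((ln 3 + 2 * ln alpha) * i n + 4 * L n)).
have Uc : U @ \oo --> phi alpha lam.
  rewrite -[X in _ --> X]addr0; apply: cvgD => //.
  rewrite -[X in _ --> X]addr0; apply: cvgD; first exact: (cvg0_lin _ _ ic ic lc).
  exact: (cvg0_lin _ _ xc ic lc).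
near=> n => P0.
have n1 : (0 < n)%N by near: n; exists 1%N.
have n0 : 0 < n%:R :> R by rewrite ltr0n.
have s0 : 0 < s n by rewrite /s sqrtr_gt0.
have nE : n%:R = s n ^+ 2 by rewrite sqr_sqrtr.
have lE : (l n)%:R = x n * s n by rewrite /x divfK // gt_eqF.
have x0 : 0 < x n by near: n; apply: (cvgr_gt alpha).
have l0 : 0 < (l n)%:R :> R by rewrite lE mulr_gt0.
have /andP[h1 _] := Hl n n1; rewrite -/(s n) in h1.
have Un : U n < phi alpha lam + eps by near: n; apply: (cvgr_lt (phi alpha lam)) => //; rewrite ltrDl.
have mu0 : 0 < lam * s n by rewrite mulr_gt0.
have H := @prob_le_upper R (lam * s n) n (l n) mu0.
have Fn := @fact_gt0R R n; have Fl := @fact_gt0R R (l n).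
have C0 : 0 < 4 / (lam * s n) ^+ 2 by rewrite divr_gt0 ?exprn_gt0.
have Ph := @Phi_gt0 R (lam * s n) (l n) mu0.
have n2 : 0 < n.+2%:R :> R by rewrite ltr0n.
have N2 : 0 < n.+2%:R ^+ l n :> R by rewrite exprn_gt0.
have F2 : 0 < (l n)`!%:R ^+ 2 :> R by rewrite exprn_gt0.
have Cn : 0 < (4 / (lam * s n) ^+ 2) ^+ n by rewrite exprn_gt0.
have M1 : 0 < n`!%:R * n.+2%:R ^+ l n :> R by apply: mulr_gt0.
have M2 : 0 < (l n)`!%:R ^+ 2 * (4 / (lam * s n) ^+ 2) ^+ n by apply: mulr_gt0.
have M3 : 0 < (l n)`!%:R ^+ 2 * (4 / (lam * s n) ^+ 2) ^+ n * Phi (lam * s n) (l n).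
  by apply: mulr_gt0.
have {H} : ln (prob_le R n (l n)) <= ln (n`!%:R * n.+2%:R ^+ l n *
   ((l n)`!%:R ^+ 2 * (4 / (lam * s n) ^+ 2) ^+ n * Phi (lam * s n) (l n))).
  by rewrite ler_ln // posrE; apply: mulr_gt0.
have -> : ln (n`!%:R * n.+2%:R ^+ l n *
   ((l n)`!%:R ^+ 2 * (4 / (lam * s n) ^+ 2) ^+ n * Phi (lam * s n) (l n))) =
   ln n`!%:R + ln (n.+2%:R ^+ l n) + (ln ((l n)`!%:R ^+ 2) +
     ln ((4 / (lam * s n) ^+ 2) ^+ n) + ln (Phi (lam * s n) (l n))).
  by rewrite lnM ?posrE // lnM ?posrE // lnM ?posrE // lnM ?posrE.
rewrite (lnX_natl _ n2) (lnX_natl _ Fl) (lnX_natl _ C0) ln4V //.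
have [_ fn] := ln_fact_bounds R n1.
have fl := ln_fact_le R (l n).
have lnn : ln n%:R = 2 * ln (s n) by rewrite nE lnX_natl.
have lnl : ln (l n)%:R <= ln alpha + ln (s n).
  by rewrite -lnM ?posrE // ler_ln ?posrE ?mulr_gt0 // ltW.
have ln2 : ln n.+2%:R <= ln 3 + 2 * ln (s n).
  have n3 : (n.+2 <= 3 * n)%N by rewrite mulSn -addn2 leq_add2l leq_pmulr.
  by rewrite -lnn -lnM ?posrE // ler_ln ?posrE ?mulr_gt0 // -natrM ler_nat.
have {}fl : ln (l n)`!%:R <= (l n)%:R * (ln alpha + ln (s n)).
  by apply: le_trans fl _; rewrite ler_wpM2l.
have {}ln2 : (l n)%:R * ln n.+2%:R <= (l n)%:R * (ln 3 + 2 * ln (s n)).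
  by rewrite ler_wpM2l.
rewrite lnn in fn.
have aE : ln (Phi (lam * s n) (l n)) = n%:R * a n.
  by rewrite /a mulrA divff ?mul1r // gt_eqF.
rewrite aE => H.
rewrite ler_pdivrMl //; apply: (@le_trans _ _ (n%:R * (- 1 + (ln 4 - 2 * ln lam) + U n))).
  have -> : n%:R * (-1 + (ln 4 - 2 * ln lam) + U n) =
    - n%:R + n%:R * (ln 4 - 2 * ln lam) + n%:R * a n + 1 + 2 * ln (s n) +
    (l n)%:R * (ln 3 + 2 * ln (s n)) + 2 * ((l n)%:R * (ln alpha + ln (s n))).
    by rewrite /U /i /L nE lE; field; rewrite gt_eqF.
  by lra.
by rewrite ler_wpM2l ?(ltW n0) //; lra.
Unshelve. all: by end_near. Qed.

(** The hypotheses on lamm and lamp place the density of boxes m / n between 1 and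
    1 + eta.  Indeed, comparing the lower bound at lam with the upper bound at
    lam' gives, up to o(1), 2 (m / n) (ln lam' - ln lam) <= phi lam' - phi lam, and the
    right side is alpha (lam' - lam) - (alpha ^ 2 / 2) (ln lam' - ln lam). *)
Lemma exponent_lower (R : realType) (alpha lam lamm lamp eta eps : R) l :
  0 < alpha < lam -> 2 <= lam -> 0 < lamm < lam -> lam < lamp ->
  1 < alpha * lamm / 2 - alpha ^+ 2 / 4 ->
  alpha * lamp / 2 - alpha ^+ 2 / 4 < 1 + eta ->
  0 < eps -> crit_index alpha l ->
  \forall n \near \oo, 0 < prob_le R n (l n) /\
    - 1 + (1 + eta) * (ln 4 - 2 * ln lam) + phi alpha lam - eps <=
    n%:R^-1 * ln (prob_le R n (l n)).
Proof.
move=> /andP[a0 al] lam2 /andP[lamm0 lamml] lampl xm xp e0 Hl.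
have lam0 : 0 < lam by lra.
have lamp0 : 0 < lamp by lra.
pose s n := Num.sqrt (n%:R : R); pose x n := (l n)%:R / s n.
pose i n := (s n)^-1; pose L n := ln (s n) / s n.
have xc : x @ \oo --> alpha := ratio_cvg Hl.
have ic : i @ \oo --> (0 : R) := @inv_sqrt_cvg0 R.
have lc : L @ \oo --> (0 : R) := @ln_sqrt_cvg0 R.
pose a lam n := n%:R^-1 * ln (Phi (lam * s n) (l n)).
have ac lam' : 0 < lam' -> a lam' @ \oo --> phi alpha lam'.
  by move=> ?; apply: Phi_asympt.
pose e1 n := x n * (ln (8 * lam) * i n + 2 * L n) + x n * (x n * (1 * i n + 0 * L n)).
pose e2 n := e1 n + x n * (2 * ln alpha * i n + 2 * L n).
have e1c : e1 @ \oo --> (0 : R).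
  rewrite -[X in _ --> X]addr0; apply: cvgD; first exact: (cvg0_lin _ _ xc ic lc).
  rewrite -[X in _ --> X](mulr0 alpha); apply: cvgM => //.
  exact: (cvg0_lin _ _ xc ic lc).
have e2c : e2 @ \oo --> (0 : R).
  rewrite -[X in _ --> X]addr0; apply: cvgD => //; exact: (cvg0_lin _ _ xc ic lc).
pose dp := ln lamp - ln lam; pose dm := ln lam - ln lamm.
have dp_gt : (lamp - lam) / lamp <= dp.
  have := @ln_ge_1subV R (lamp / lam); rewrite divr_gt0 // ln_div ?posrE // => /(_ isT).
  by rewrite invf_div mulrBl divff ?gt_eqF.
have dm_lt : dm <= (lam - lamm) / lamm.
  have := @ln_le_subr1 R (lam / lamm); rewrite divr_gt0 // ln_div ?posrE // => /(_ isT).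
  by rewrite mulrBl divff ?gt_eqF.
have dp0 : 0 < dp by apply: lt_le_trans dp_gt; rewrite divr_gt0 // subr_gt0.
have dm0 : 0 < dm by rewrite subr_gt0 ltr_ln ?posrE.
have phiB lam' : 0 < lam' -> phi alpha lam' - phi alpha lam =
    alpha * (lam' - lam) - alpha ^+ 2 / 2 * (ln lam' - ln lam).
  by move=> l0; rewrite /phi !ln_div ?posrE //; ring.
pose Dp n := a lamp n - a lam n + e2 n - (1 + eta) * (2 * dp - 2 * i n).
have Dpc : Dp @ \oo --> (phi alpha lamp - phi alpha lam + 0 - (1 + eta) * (2 * dp - 2 * 0)).
  apply: cvgB; first by apply: cvgD => //; apply: cvgB; apply: ac.
  apply: cvgM; first exact: cvg_cst.
  apply: cvgB; first exact: cvg_cst.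
  by apply: cvgM => //; apply: cvg_cst.
have Dp_lim : phi alpha lamp - phi alpha lam + 0 - (1 + eta) * (2 * dp - 2 * 0) < 0.
  rewrite phiB // -/dp.
  have : lamp - lam <= dp * lamp by rewrite -ler_pdivrMr.
  move: dp0 xp; clear -a0; nra.
pose Dm n := a lamm n - a lam n + e2 n + (2 * dm + 2 * i n).
have Dmc : Dm @ \oo --> (phi alpha lamm - phi alpha lam + 0 + (2 * dm + 2 * 0)).
  apply: cvgD; first by apply: cvgD => //; apply: cvgB; apply: ac.
  apply: cvgD; first exact: cvg_cst.
  by apply: cvgM => //; apply: cvg_cst.
have Dm_lim : phi alpha lamm - phi alpha lam + 0 + (2 * dm + 2 * 0) < 0.
  rewrite phiB // (_ : ln lamm - ln lam = - dm); last by rewrite /dm opprB.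
  have : dm * lamm <= lam - lamm by rewrite -ler_pdivlMr.
  move: dm0 xm; clear -a0; nra.
pose W n := a lam n - e1 n - 2 * (1 + eta) * i n.
have Wc : W @ \oo --> phi alpha lam.
  rewrite -[X in _ --> X]subr0; apply: cvgB; last first.
    rewrite -[X in _ --> X](mulr0 (2 * (1 + eta))); apply: cvgM => //; exact: cvg_cst.
  rewrite -[X in _ --> X]subr0; apply: cvgB => //; exact: ac.
pose K := (1 - Num.sqrt (alpha / lam)) ^+ 2 * lam.
have K0 : 0 < K.
  have q1 : alpha / lam < 1 by rewrite ltr_pdivrMr // mul1r.
  by rewrite mulr_gt0 // exprn_gt0 // subr_gt0 -[ltRHS]sqrtr1 ltr_sqrt.
have Kc : (fun n => 8 * alpha / K ^+ 2 * i n) @ \oo --> (0 : R).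
  by rewrite -[X in _ --> X](mulr0 (8 * alpha / K ^+ 2)); apply: cvgM => //; apply: cvg_cst.
near=> n.
have n1 : (0 < n)%N by near: n; exists 1%N.
have n0 : 0 < n%:R :> R by rewrite ltr0n.
have s1 : 1 <= s n by rewrite /s -[leLHS]sqrtr1 ler_wsqrtr // ler1n.
have s0 : 0 < s n by apply: lt_le_trans s1.
have nE : n%:R = s n ^+ 2 by rewrite sqr_sqrtr.
have lE : (l n)%:R = x n * s n by rewrite /x divfK // gt_eqF.
have x0 : 0 < x n by near: n; apply: (cvgr_gt alpha).
have l0 : 0 < (l n)%:R :> R by rewrite lE mulr_gt0.
have /andP[h1 _] := Hl n n1; rewrite -/(s n) in h1.
have i0 : 0 < i n by rewrite invr_gt0.
have idp : i n < dp by near: n; apply: (cvgr_lt 0).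
have Dpn : Dp n < 0 by near: n; apply: (cvgr_lt _ Dpc).
have Dmn : Dm n < 0 by near: n; apply: (cvgr_lt _ Dmc).
have Wn : phi alpha lam - eps < W n.
  by near: n; apply: (cvgr_gt (phi alpha lam)) => //; rewrite ltrBlDr ltrDl.
have Kn : 8 * alpha / K ^+ 2 * i n <= 1 / 2.
  by near: n; apply: (cvgr_le 0) => //; rewrite divr_gt0.
have le : (l n)%:R * expR (- ((1 - Num.sqrt (alpha / lam)) ^+ 2 * (lam * s n)) / 2) <= 1 / 2.
  apply: le_trans Kn; rewrite mulNr expRN ler_pdivrMr ?expR_gt0 //.
  have z0 : 0 <= K * s n / 2 by rewrite divr_ge0 // mulr_ge0 // ltW.
  have := exp_coeff_le 2 z0; rewrite {1}/K mulrA -/K.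
  rewrite (_ : (2`!)%:R = 2 :> R) // => He.
  have c0 : 0 <= 8 * alpha / K ^+ 2 * i n by rewrite !mulr_ge0 ?invr_ge0 ?exprn_ge0 // ltW.
  apply: le_trans (ltW h1) (le_trans _ (ler_wpM2l c0 He)).
  rewrite le_eqVlt; apply/orP; left; apply/eqP.
  by rewrite /i; field; rewrite !gt_eqF.
have aal : 0 < alpha < lam by rewrite a0.
have [m [g g0 [H1 H2 H3]]] := near_optimal_shape aal s1 h1 le.
pose y := m%:R / n%:R : R.
have mE : m%:R = y * n%:R by rewrite /y divfK // gt_eqF.
have y0 : 0 <= y by rewrite divr_ge0.
have aE lam' : ln (Phi (lam' * s n) (l n)) = n%:R * a lam' n.
  by rewrite /a mulrA divff ?mul1r // gt_eqF.
have lnl : ln (l n)%:R <= ln alpha + ln (s n).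
  by rewrite -lnM ?posrE // ler_ln ?posrE ?mulr_gt0 // ltW.
have fl : ln (l n)`!%:R <= (l n)%:R * (ln alpha + ln (s n)).
  by apply: le_trans (ln_fact_le R (l n)) _; rewrite ler_wpM2l // ltW.
have e1E : n%:R * e1 n = (l n)%:R * (ln (8 * lam) + 2 * ln (s n)) + (l n)%:R ^+ 2 / s n.
  by rewrite /e1 /i /L nE lE; field; rewrite gt_eqF.
have e2E : n%:R * e2 n = n%:R * e1 n + 2 * ((l n)%:R * (ln alpha + ln (s n))).
  by rewrite /e2 /i /L nE lE; field; rewrite gt_eqF.
have comp lam' : 0 < lam' -> y * (2 * (ln lam' - ln lam) - 2 * i n) <=
    a lam' n - a lam n + e2 n.
  move=> l'0; rewrite -(ler_pM2l n0).
  have := le_trans H1 (H2 lam' l'0); rewrite !aE mE => H.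
  have -> : n%:R * (y * (2 * (ln lam' - ln lam) - 2 * i n)) =
    2 * (y * n%:R) * (ln lam' - ln lam) - 2 * (y * n%:R) / s n by rewrite /i; ring.
  have -> : n%:R * (a lam' n - a lam n + e2 n) =
    n%:R * a lam' n - n%:R * a lam n + n%:R * e2 n by ring.
  rewrite e2E e1E.
  rewrite (mulrDl _ _ (s n)^-1) in H.
  by move: H fl; clear; lra.
(* lam' = lamm < lam: the comparison bounds m / n from below. *)
have ym : 1 < y.
  have F (q ii d z : R) : 0 < d -> 0 < ii -> q + (2 * d + 2 * ii) < 0 ->
    z * (2 * - d - 2 * ii) <= q -> 1 < z by nra.
  apply: F dm0 i0 Dmn _; rewrite /dm opprB; exact: comp.
(* lam' = lamp > lam: the comparison bounds m / n from above. *)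
have yp : y < 1 + eta.
  have F (q ii d z : R) : ii < d -> q - (1 + eta) * (2 * d - 2 * ii) < 0 ->
    z * (2 * d - 2 * ii) <= q -> z < 1 + eta by nra.
  by apply: F idp Dpn _; apply: comp.
have nm : (n <= m)%N.
  by rewrite -(ler_nat R) mE ler_peMl ?(ltW n0) // ltW.
have Pg := H3 n nm.
have Fm := @fact_gt0R R m.
have mg : 0 < m`!%:R * g by apply: mulr_gt0.
have Pn : 0 < prob_le R n (l n) by apply: lt_le_trans mg Pg.
split => //.
have : ln (m`!%:R * g) <= ln (prob_le R n (l n)) by rewrite ler_ln.
rewrite lnM ?posrE // => HP.
have Hm := @ln_natr_fact_ge R n m n1.
have lnn : ln n%:R = 2 * ln (s n) by rewrite nE lnX_natl.
rewrite lnn in Hm.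
rewrite ler_pdivlMl //.
apply: (@le_trans _ _ (n%:R * (- 1 + y * (ln 4 - 2 * ln lam) + a lam n - e1 n - 2 * y * i n))).
    (* ln (4 / lam ^ 2) is at most 0, so the upper bound on y is the useful one. *)
have q0 : ln 4 - 2 * ln lam <= 0.
    rewrite subr_le0 -lnX_natl // ler_ln ?posrE ?exprn_gt0 //.
    by rewrite (_ : (4 : R) = 2 ^+ 2) ?lerXn2r ?nnegrE ?(ltW lam0) //; ring.
  rewrite ler_wpM2l ?(ltW n0) //.
  have F (q aa ee ii z p : R) : p - eps < aa - ee - 2 * (1 + eta) * ii ->
    z < 1 + eta -> q <= 0 -> 0 < ii ->
    - 1 + (1 + eta) * q + p - eps <= - 1 + z * q + aa - ee - 2 * z * ii by nra.
  exact: F Wn yp q0 i0.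
apply: le_trans HP.
have -> : n%:R * (- 1 + y * (ln 4 - 2 * ln lam) + a lam n - e1 n - 2 * y * i n) =
  - n%:R + (y * n%:R) * (ln 4 - 2 * ln lam) + n%:R * a lam n - n%:R * e1 n
  - 2 * (y * n%:R) / s n by rewrite /i; ring.
rewrite e1E.
rewrite (mulrDl _ _ (s n)^-1) in H1.
move: H1 Hm; rewrite aE mE; clear; lra.
Unshelve. all: by end_near. Qed.

(** * The theorem *)

Lemma crit_index_exists (R : realType) (alpha : R) : 0 < alpha ->
  exists l, crit_index alpha l.
Proof.
move=> a0.
have H n : exists k : nat, (0 < n)%N ->
    k%:R < alpha * Num.sqrt (n%:R : R) <= k.+1%:R.
  have x0 : 0 <= alpha * Num.sqrt (n%:R : R) by rewrite mulr_ge0 ?sqrtr_ge0 // ltW.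
  have Hb : exists m : nat, alpha * Num.sqrt (n%:R : R) <= m%:R.
    by exists (Num.bound (alpha * Num.sqrt (n%:R : R))); apply/ltW/archi_boundP.
  case: (ex_minnP Hb) => -[|m] Hm mmin; last first.
    exists m => _; rewrite Hm andbT ltNge; apply/negP => /mmin; by rewrite ltnn.
  exists 0%N => n0; have : 0 < alpha * Num.sqrt (n%:R : R).
    by rewrite mulr_gt0 // sqrtr_gt0 ltr0n.
  by rewrite ltNge Hm.
by have [l Hl] := choice H; exists l.
Qed.

Lemma prob_Lmax_lt_le (R : realType) (alpha : R) l n : crit_index alpha l -> (0 < n)%N ->
  prob_Lmax_lt n (alpha * Num.sqrt (n%:R : R)) = prob_le R n (l n).
Proof.
move=> Hl n0; have /andP[h1 h2] := Hl n n0.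
rewrite /prob_Lmax_lt /prob_le; congr (Defs.uniform_prob R _).
apply/setP => s; rewrite !inE; apply/idP/idP => H.
  by have := lt_le_trans H h2; rewrite ltr_nat ltnS.
by apply: le_lt_trans h1; rewrite ler_nat.
Qed.

(** The value of lam for which alpha lam / 2 - alpha ^ 2 / 4 = 1, that is, for which
    the near optimal shapes have about n boxes. *)
Lemma rate_value (R : realType) (c : R) : -2 < c ->
  let lam := (4 + (2 + c) ^+ 2) / (2 * (2 + c)) in
  - 2 * H0 c = - 1 + (ln 4 - 2 * ln lam) + phi (2 + c) lam.
Proof.
move=> hc lam; rewrite /H0 (addrC c 2) /phi.
have a0 : 0 < 2 + c by lra.
move: (2 + c) a0 @lam => a a0 lam.
have d0 : 0 < 4 + a ^+ 2 by have := sqr_ge0 a; lra.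
pose Q := 2 * a ^+ 2 / (4 + a ^+ 2).
have Q0 : 0 < Q by rewrite divr_gt0 // mulr_gt0 // exprn_gt0.
have lE : lam = a / Q.
  by rewrite /lam /Q; field; rewrite ?gt_eqF.
have -> : a / lam = Q by rewrite lE; field; rewrite !gt_eqF.
have LE : ln lam = ln a - ln Q by rewrite lE ln_div ?posrE.
rewrite -/Q LE (_ : ln (a / 2) = ln a - ln 2); last by rewrite ln_div ?posrE.
have -> : ln (4 : R) = 2 * ln 2.
  by rewrite -(@lnX_natl R 2 2) // (_ : (4 : R) = 2 ^+ 2) //; ring.
by rewrite /lam; field; rewrite gt_eqF.
Qed.

(* The library sets ln 0 = 0; the probability vanishes only for the finitely
   many n with (2 + c) * sqrt n <= 1, so the limit is not affected. *)
Theorem theorem1 (R : realType) (c : R) (hc : -2 < c) (hc0 : c <= 0) :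
  (fun n : nat =>
     n%:R^-1 * ln (prob_Lmax_lt n ((2 + c) * Num.sqrt (n%:R : R))))
    @ \oo --> - 2 * H0 c.
Proof.
rewrite rate_value //; set lam0 := _ / _.
have a0 : 0 < 2 + c by lra.
have a2 : 2 + c <= 2 by lra.
move: (2 + c) a0 a2 @lam0 => alpha a0 a2 lam0.
have lamE : alpha * lam0 = (4 + alpha ^+ 2) / 2 by rewrite /lam0; field; rewrite gt_eqF.
have lam00 : 0 < lam0.
  by rewrite divr_gt0 ?mulr_gt0 //; have := sqr_ge0 alpha; lra.
have lam2 : 2 <= lam0.
  rewrite -(ler_pM2l a0) lamE; have := sqr_ge0 (alpha - 2); lra.
have [l Hl] := crit_index_exists a0.
(* The lower exponent for lam = lam0 + d; it is continuous at d = 0, where it is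
   the limit. *)
pose K (d : R) := - 1 + (1 + 2 * alpha * d) * (ln 4 - 2 * ln (lam0 + d)) +
  (alpha ^+ 2 / 2 * (ln alpha - ln (lam0 + d)) - 3 / 4 * alpha ^+ 2 + (lam0 + d) * alpha).
have KE d : 0 < lam0 + d -> K d =
    - 1 + (1 + 2 * alpha * d) * (ln 4 - 2 * ln (lam0 + d)) + phi alpha (lam0 + d).
  by move=> d0; rewrite /K /phi ln_div ?posrE.
have dc : (fun k => lam0 + harmonic k) @ \oo --> lam0.
  rewrite -[X in _ --> X]addr0; apply: cvgD; first exact: cvg_cst.
  exact: cvg_harmonic.
have lnc : (fun k => ln (lam0 + harmonic k)) @ \oo --> ln lam0.
  exact: (cvg_comp _ _ dc (continuous_ln lam00)).
have Kc : (fun k => K (harmonic k)) @ \oo --> K 0.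
  rewrite /K addr0; apply: cvgD; last first.
    apply: cvgD; last by apply: cvgM => //; apply: cvg_cst.
    apply: cvgB; last exact: cvg_cst.
    by apply: cvgM; [exact: cvg_cst | apply: cvgB => //; apply: cvg_cst].
  apply: cvgD; first exact: cvg_cst.
  apply: cvgM; last first.
    apply: cvgB; first exact: cvg_cst.
    by apply: cvgM => //; apply: cvg_cst.
  apply: cvgD; first exact: cvg_cst.
  by apply: cvgM; [exact: cvg_cst | exact: cvg_harmonic].
apply/cvgrPdist_le => e e0.
have e2 : 0 < e / 2 by rewrite divr_gt0.
have [k Kk] : exists k, K 0 - e / 2 < K (harmonic k).
  have [N _ HN] : \forall k \near \oo, K 0 - e / 2 < K (harmonic k).
    by apply: (cvgr_gt (K 0)) => //; rewrite ltrBlDr ltrDl.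
  by exists N; apply: HN => /=.
pose d : R := harmonic k.
have Kd : K 0 - e / 2 < K d by exact: Kk.
have d0 : 0 < d by rewrite invr_gt0 ltr0n.
have ad0 : 0 < alpha * d by rewrite mulr_gt0.
have Low := @exponent_lower R alpha (lam0 + d) (lam0 + d / 2) (lam0 + 2 * d)
  (2 * alpha * d) (e / 2) l.
have {}Low := Low _ _ _ _ _ _ e2 Hl.
have Upp := @exponent_upper R alpha lam0 e l a0 lam00 e0 Hl.
near=> n.
have n1 : (0 < n)%N by near: n; exists 1%N.
rewrite (prob_Lmax_lt_le Hl n1).
have [P0 lo] : 0 < prob_le R n (l n) /\
   - 1 + (1 + 2 * alpha * d) * (ln 4 - 2 * ln (lam0 + d)) + phi alpha (lam0 + d) - e / 2 <=
    n%:R^-1 * ln (prob_le R n (l n)).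
  near: n; apply: Low.
  - by apply/andP; split => //; lra.
  - by lra.
  - by apply/andP; split; lra.
  - by lra.
  - by rewrite mulrDr lamE; lra.
  - by rewrite mulrDr lamE; lra.
have up : n%:R^-1 * ln (prob_le R n (l n)) <=
    - 1 + (ln 4 - 2 * ln lam0) + phi alpha lam0 + e.
  by move: P0; near: n; apply: Upp.
rewrite -KE in lo; last by rewrite addr_gt0.
have K0 : K 0 = - 1 + (ln 4 - 2 * ln lam0) + phi alpha lam0.
  by rewrite KE addr0 // mulr0 addr0 mul1r.
rewrite -K0 in up *; rewrite ler_norml; apply/andP; split; lra.
Unshelve. all: by end_near. Qed.
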